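(* There exist absolute constants $c>0$ and $d_0$ such that for all $d\ge d_0$, all $\kappa$ with $10\le\kappa\le d^4$, and every step size $h>0$, there exist a twice-differentiable $f:\mathbb{R}^d\to\mathbb{R}$ with $I\preceq\nabla^2 f(x)\preceq\kappa I$ for all $x$, and a probability distribution $\pi_0$ with $\frac{d\pi_0}{d\pi}(x)\le e^{d}$ for all $x$ (where $\pi\propto e^{-f}$), such that for every $T\le c\,\kappa d/\log^2 d$, the law $\pi_T$ of the MALA chain with step size $h$ after $T$ iterations started from $x_0\sim\pi_0$ satisfies $\|\pi_T-\pi\|_{\mathrm{TV}}>1/e$.
   Context: For $f:\mathbb{R}^d\to\mathbb{R}$ differentiable with $\int e^{-f}<\infty$, let $\pi$ denote the probability measure with density proportional to $e^{-f}$. The MALA Markov chain with step size $h>0$: from $x$, propose $y=x-h\nabla f(x)+\sqrt{2h}\,g$ with $g\sim\mathcal N(0,I_d)$; move to $y$ with probability $\min\{1,\exp(f(x)-f(y)+\frac{1}{4h}(\|y-x+h\nabla f(x)\|_2^2-\|x-y+h\nabla f(y)\|_2^2))\}$, otherwise stay at $x$. $\|\mu-\nu\|_{\mathrm{TV}}=\sup_A|\mu(A)-\nu(A)|$. *)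

(* Defs.v *)
From HB Require Import structures.
From mathcomp Require Import all_boot all_order all_algebra.
From mathcomp Require Import all_classical all_reals all_analysis.
Set Implicit Arguments.
Unset Strict Implicit.
Unset Printing Implicit Defensive.
Import Order.TTheory GRing.Theory Num.Theory.
Import numFieldNormedType.Exports.
Local Open Scope classical_set_scope.
Local Open Scope ring_scope.

(* R^d is 'rV[R]_d.  We equip it with the product (= Borel) sigma-algebra,
   generated by the coordinate projections x |-> x_i.                  *)
Definition rV_display : measure_display. Proof. exact: default_measure_display. Qed.

Section measurable_rV.
Context (R : realType) (n : nat).

Let coor : 'I_n -> 'rV[R]_n -> R := fun i x => x ord0 i.

Let rV_set0 : g_sigma_preimage coor set0.
Proof. exact: sigma_algebra0. Qed.

Let rV_setC A : g_sigma_preimage coor A -> g_sigma_preimage coor (~` A).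
Proof. exact: sigma_algebraC. Qed.

Let rV_bigcup (F : _^nat) : (forall i, g_sigma_preimage coor (F i)) ->
  g_sigma_preimage coor (\bigcup_i (F i)).
Proof. exact: sigma_algebra_bigcup. Qed.

HB.instance Definition _ := @isMeasurable.Build rV_display
  ('rV[R]_n) (g_sigma_preimage coor) rV_set0 rV_setC rV_bigcup.
End measurable_rV.

Section mala_defs.
Context {R : realType} {n : nat}.
Local Notation V := 'rV[R]_n.
Implicit Types (f : V -> R) (x y g v : V).

Definition ev (i : 'I_n) : V := delta_mx 0 i.

Definition grad f x : V := \row_i 'D_(ev i) f x.
Definition hess f x : 'M[R]_n :=
  \matrix_(i, j) 'D_(ev j) (fun y => 'D_(ev i) f y) x.

Definition twice_differentiable f :=
  (forall x, differentiable f x) /\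
  (forall (i : 'I_n) x, differentiable (fun y => 'D_(ev i) f y) x).

Definition sqnorm v : R := \sum_i v ord0 i ^+ 2.
Definition quadform (H : 'M[R]_n) v : R :=
  \sum_i \sum_j v ord0 i * H i j * v ord0 j.

Definition hessian_bounded f (kappa : R) :=
  forall x v, sqnorm v <= quadform (hess f x) v <= kappa * sqnorm v.

(* lam is Lebesgue measure on R^n: it gives half-open boxes their volume
   (this characterizes Lebesgue measure on the Borel sets uniquely) *)
Definition is_lebesgue (lam : {measure set V -> \bar R}) :=
  forall a b : V, (forall i, a ord0 i <= b ord0 i) ->
    lam [set x | forall i, a ord0 i < x ord0 i <= b ord0 i] =
    (\prod_i (b ord0 i - a ord0 i))%:E.

Definition gauss_density g : R :=
  (Num.sqrt (2 * pi)) ^- n * expR (- sqnorm g / 2).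

Definition target (lam : {measure set V -> \bar R}) f : set V -> \bar R :=
  let Z := fine (\int[lam]_x (expR (- f x))%:E)%E in
  fun A => (\int[lam]_(x in A) (expR (- f x) / Z)%:E)%E.

Definition mala_prop (h : R) f x g : V := x - h *: grad f x + Num.sqrt (2 * h) *: g.
Definition mala_accept (h : R) f x y : R :=
  Num.min 1 (expR (f x - f y + (4 * h)^-1 *
     (sqnorm (y - x + h *: grad f x) - sqnorm (x - y + h *: grad f y)))).

Definition mala_kernel (lam : {measure set V -> \bar R}) (h : R) f x (A : set V) : \bar R :=
  (\int[lam]_g (gauss_density g * mala_accept h f x (mala_prop h f x g)
                 * \1_A (mala_prop h f x g))%:E
  + (1 - \int[lam]_g (gauss_density g * mala_accept h f x (mala_prop h f x g))%:E)
      * (\1_A x)%:E)%E.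

Fixpoint mala_law (lam : {measure set V -> \bar R}) (h : R) f (pi0 : set V -> \bar R)
    (T : nat) : set V -> \bar R :=
  match T with
  | 0 => pi0
  | t.+1 => fun A => integral (mala_law lam h f pi0 t) setT
                 (fun x => mala_kernel lam h f x A)
  end.

Definition tv_dist (mu nu : set V -> \bar R) : \bar R :=
  ereal_sup [set (`|mu A - nu A|)%E | A in [set A : set V | measurable A]].

Definition density_bounded (pi pi0 : set V -> \bar R) (M : R) :=
  exists rho : V -> R, measurable_fun setT rho /\
    (forall x, 0 <= rho x <= M) /\
    (forall A, measurable A -> pi0 A = integral pi A (fun x => (rho x)%:E)).

End mala_defs.

(* Main.v *)
(* Write u = h kappa; three regimes of the step size call for three targets, all
   of the form f(x) = sum_i phi_i(x_i), so that the target, the Gaussian proposal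
   and an exponential bound on the acceptance ratio all factor over coordinates.

   If u >= 1, take f = kappa |x|^2 / 2 and start in a box on the scale
   kappa^(-1/2): each coordinate multiplies the expected acceptance ratio by at
   most 19/20, so the chain does not leave the box, whose target mass is small.

   If C ln^2 d / d < u <= 1, spend the warmness budget e^d on m ~ d / ln d
   coordinates with phi(t) = kappa t^2 / 4 + (kappa h / 8) t^2 / (h + t^2),
   confined to a window of width ~ u sqrt h around 0.  There the trapezoidal
   error of phi along a proposal is nonpositive, and of order -u with constant
   probability, so each such coordinate costs a factor exp(-c u).  As
   m u >= C' ln d, the acceptance probability is at most d^(-6), whereas
   T <= c kappa d <= d^5.  The remaining coordinates are standard Gaussian, whose
   expected acceptance ratio is at most 1 on the starting window.

   If u <= C ln^2 d / d, take f = |x|^2 / 2.  The acceptance rule then favours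
   small |y|, so for V = exp(|x|^2 / 8) an accepted-or-rejected move satisfies
   a V(y) + (1 - a) V(x) <= V(y), and V grows by at most exp(h d / 2) in mean per
   step.  Started in a box with |x|^2 <= d / 2, the chain still has
   |x|^2 < 3 d / 4 after T <= 1 / (32 h) steps with high probability, which is
   exponentially unlikely under the target. *)
Require Import Defs.
From HB Require Import structures.
From mathcomp Require Import all_boot all_order all_algebra.
From mathcomp Require Import all_classical all_reals all_analysis.
From mathcomp Require Import measurable_realfun ring lra.
Import Order.TTheory GRing.Theory Num.Theory.
Import numFieldNormedType.Exports.
Import HBNNSimple.
Set Implicit Arguments.
Unset Strict Implicit.
Unset Printing Implicit Defensive.
Local Open Scope classical_set_scope.
Local Open Scope ring_scope.

(** * Measures with a density *)

(** The law of the chain is a bare set function, not a bundled measure. Its integrals still see only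
    measurable sets, since they are suprema over simple functions, whose level sets are
    measurable. *)
Lemma eq_integral_on_measurable d (T : measurableType d) (R : realType)
    (m1 m2 : set T -> \bar R) (D : set T) (f : T -> \bar R) :
  (forall A, measurable A -> m1 A = m2 A) ->
  integral m1 D f = integral m2 D f.
Proof.
move=> m12; rewrite /integral.
have E (h : {nnsfun T >-> R}) : sintegral m1 h = sintegral m2 h.
  rewrite /sintegral; apply: eq_fsbigr => x _; congr (_ * _)%E.
  by apply: m12; exact: measurable_funPTI.
by congr (ereal_sup _ - ereal_sup _)%E; apply/seteqP; split => x [h hf <-];
  exists h => //; rewrite E.
Qed.

(** For nonnegative integrands the integral is a supremum over the simple functions below, and a
    larger integrand admits more of them. This compares integrands such as [mala_kernel]
    directly. *)
Lemma ge0_le_integralT d (T : measurableType d) (R : realType)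
    (mu : {measure set T -> \bar R}) (f g : T -> \bar R) :
  (forall x, 0 <= f x)%E -> (forall x, f x <= g x)%E ->
  (\int[mu]_x f x <= \int[mu]_x g x)%E.
Proof.
move=> f0 fg; rewrite !ge0_integralTE//; last first.
  by move=> x; exact: le_trans (f0 x) (fg x).
apply: ereal_sup_le => _ [h hf <-]; exists h => // x.
exact: le_trans (hf x) (fg x).
Qed.

(** The measure is [A |-> \int[mu]_(x in A) rho x]. The change-of-density formula holds for
    indicators, hence for simple functions, hence for all nonnegative measurable functions by
    monotone convergence. *)
Lemma density_measure d (T : measurableType d) (R : realType)
    (mu : {measure set T -> \bar R}) (rho : T -> R) :
  measurable_fun setT rho -> (forall x, 0 <= rho x) ->
  exists m : {measure set T -> \bar R}, forall W : T -> \bar R,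
    measurable_fun setT W -> (forall x, 0 <= W x)%E ->
    (\int[m]_x W x = \int[mu]_x ((rho x)%:E * W x))%E.
Proof.
move=> mrho rho0.
pose m0 (A : set T) := (\int[mu]_(x in A) (rho x)%:E)%E.
have m00 : m0 set0 = 0%E by rewrite /m0 integral_set0.
have m0_ge0 A : (0 <= m0 A)%E by by apply: integral_ge0 => x _; rewrite lee_fin.
have m0_sigma : semi_sigma_additive m0.
  move=> A mA tA mUA; rewrite /m0 ge0_integral_bigcup//; last 2 first.
  - by apply/measurable_EFinP; exact: measurable_funTS.
  - by move=> x _; rewrite lee_fin.
  by apply: is_cvg_ereal_nneg_natsum_cond => n _ _; exact: m0_ge0.
pose m : {measure set T -> \bar R} :=
  HB.pack m0 (isMeasure.Build _ _ _ m0 m00 m0_ge0 m0_sigma).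
exists m => W mW W0.
pose W_ := nnsfun_approx measurableT mW.
have nnsf (h : {nnsfun T >-> R}) :
    (\int[m]_x (h x)%:E = \int[mu]_x ((rho x)%:E * (h x)%:E))%E.
  under [in LHS]eq_integral do rewrite fimfunE -fsumEFin//.
  under [in RHS]eq_integral do rewrite fimfunE -fsumEFin//.
  rewrite ge0_integral_fsum//; last 2 first.
  - by move=> r; exact/measurable_EFinP/measurableT_comp.
  - by move=> r z _; rewrite EFinM nnfun_muleindic_ge0.
  under [in RHS]eq_integral.
    move=> x _; rewrite ge0_mule_fsumr; last first.
      by move=> r; rewrite EFinM nnfun_muleindic_ge0.
    over.
  rewrite [in RHS]ge0_integral_fsum//; last 2 first.
  - move=> r; apply: emeasurable_funM; first exact/measurable_EFinP.
    exact/measurable_EFinP/measurableT_comp.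
  - by move=> r z _; apply: mule_ge0; [by rewrite lee_fin|
      by rewrite EFinM nnfun_muleindic_ge0].
  apply: eq_fsbigr => r _.
  have [r0|r0] := leP 0 r; last first.
    rewrite !integral0_eq// => x _.
      by rewrite preimage_nnfun0// indic0 mulr0 mule0.
    by rewrite preimage_nnfun0// indic0 mulr0.
  under [in LHS]eq_integral do rewrite EFinM.
  under [in RHS]eq_integral do rewrite EFinM muleCA.
  have mi : measurable_fun setT (fun x => (\1_(h @^-1` [set r]) x)%:E : \bar R).
    by apply/measurable_EFinP; exact: measurable_indic.
  rewrite (ge0_integralZl_EFin m)//.
  rewrite (ge0_integralZl_EFin mu)//; last 2 first.
  - by move=> x _; apply: mule_ge0; rewrite lee_fin.
  - by apply: emeasurable_funM => //; exact/measurable_EFinP.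
  congr (_ * _)%E; rewrite integral_indic// setIT.
  rewrite /= /m0 integral_mkcond; apply: eq_integral => x _.
  by rewrite epatch_indic.
(* [W] is replaced by its increasing simple approximations, and monotone convergence is applied
   under [m] and then under [mu]. *)
transitivity (\int[m]_x (lim ((W_ n x)%:E @[n --> \oo])))%E.
  by apply/eq_integral => z _; apply/esym/cvg_lim => //=; exact: cvg_nnsfun_approx.
rewrite monotone_convergence//; last 3 first.
- by move=> n; exact/measurable_EFinP.
- by move=> n z _; rewrite lee_fin.
- by move=> z _ a b ab; rewrite lee_fin; exact/lefP/nd_nnsfun_approx.
transitivity (limn (fun n => \int[mu]_x ((rho x)%:E * (W_ n x)%:E)))%E.
  by congr (limn _); apply/funext => n; rewrite nnsf.
rewrite -monotone_convergence//; last 3 first.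
- by move=> n; apply: emeasurable_funM => //; exact/measurable_EFinP.
- by move=> n z _; rewrite mule_ge0// lee_fin.
- move=> z _ a b ab; rewrite lee_pmul// ?lee_fin//.
  exact/lefP/nd_nnsfun_approx.
apply: eq_integral => x _; apply/cvg_lim => //.
have Wx : (W_ n x)%:E @[n --> \oo] --> W x by exact: cvg_nnsfun_approx.
by apply: cvgeZl.
Qed.

(** The image under [phi] of the measure with density [rho]. It serves for weighted marginals on a
    coordinate and for the accepted and rejected parts of one step of the chain. *)
Lemma weighted_pushforward_measure d1 d2 (T1 : measurableType d1)
    (T2 : measurableType d2) (R : realType) (mu : {measure set T1 -> \bar R})
    (rho : T1 -> R) (phi : T1 -> T2) :
  measurable_fun setT rho -> (forall x, 0 <= rho x) -> measurable_fun setT phi ->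
  exists m : {measure set T2 -> \bar R}, forall W : T2 -> \bar R,
    measurable_fun setT W -> (forall x, 0 <= W x)%E ->
    (\int[m]_x W x = \int[mu]_x ((rho x)%:E * W (phi x)))%E.
Proof.
move=> mrho rho0 mphi; have [m mE] := density_measure mu mrho rho0.
pose push : {measure set T2 -> \bar R} := pushforward m phi.
exists (push mphi) => W mW W0.
rewrite ge0_integral_pushforward// preimage_setT mE//.
  exact: measurableT_comp.
by move=> x; exact: W0.
Qed.

Lemma probability_of_measure d (T : measurableType d) (R : realType)
    (m : {measure set T -> \bar R}) : m setT = 1%E ->
  exists P : probability T R, forall A, P A = m A.
Proof.
move=> m1.
pose f : set T -> \bar R := m.
have f0 : f set0 = 0%E by exact: measure0.
have fge0 A : (0 <= f A)%E by exact: measure_ge0.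
have fs : semi_sigma_additive f by exact: measure_semi_sigma_additive.
pose M := isMeasure.Build _ _ _ f f0 fge0 fs.
pose f' : {measure set T -> \bar R} := HB.pack f M.
pose P : probability T R := HB.pack f M (Measure_isProbability.Build _ _ _ f' m1).
by exists P.
Qed.

(** * Lebesgue measure on row vectors *)

Lemma measurable_coord (R : realType) n (i : 'I_n) :
  measurable_fun setT (fun x : 'rV[R]_n => x ord0 i).
Proof.
move=> _ B mB; rewrite setTI; apply: sub_sigma_algebra => /=.
rewrite (bigD1 i)//=; left; exists B => //; exact: setTI.
Qed.

Lemma measurable_prod_coord (R : realType) n (P : pred 'I_n) (f : 'I_n -> R -> R) :
  (forall i, measurable_fun setT (f i)) ->
  measurable_fun setT (fun x : 'rV[R]_n => \prod_(i | P i) f i (x ord0 i)).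
Proof.
move=> mf.
have -> : (fun x : 'rV[R]_n => \prod_(i | P i) f i (x ord0 i)) =
   (fun x : 'rV[R]_n => \prod_(i <- enum P) f i (x ord0 i)).
  by apply/funext => x; rewrite big_enum.
apply: measurable_prod => i _.
exact: measurableT_comp (mf i) (measurable_coord i).
Qed.

Lemma integral_indic_ocitv (R : realType) (a b : R) : a <= b ->
  (\int[lebesgue_measure]_x (\1_(`]a, b]%classic : set R) x)%:E = (b - a)%:E)%E.
Proof.
move=> ab; rewrite integral_indic//= setIT lebesgue_measure_itv/= lte_fin.
by case: ltgtP ab => // -> _; rewrite subrr.
Qed.

(** Dividing [M] by [k] gives the Lebesgue values on half-open intervals, which determine Lebesgue
    measure; so [M] is [k] times Lebesgue measure. *)
Lemma lebesgue_integral_of_ocitv (R : realType) (M : {measure set (measurableTypeR R) -> \bar R})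
    (k : R) (f : R -> R) (c : R) : 0 < k ->
  (forall a b, a < b -> M `]a, b]%classic = (k * (b - a))%:E) ->
  measurable_fun setT f -> (forall x, 0 <= f x) ->
  (\int[lebesgue_measure]_x (f x)%:E = c%:E)%E ->
  (\int[M]_x (f x)%:E = (k * c)%:E)%E.
Proof.
move=> k0 Mk mf f0 fc.
have kV : 0 <= k^-1 by rewrite invr_ge0 ltW.
pose N : {measure set (measurableTypeR R) -> \bar R} := mscale (NngNum kV) M.
have NE A : measurable A -> lebesgue_measure A = N A.
  apply: lebesgue_measure_unique => _ [[a b] _ <-] /=.
  rewrite lebesgue_measure_itv/= lte_fin /mscale/=.
  case: ltP => [ab|ba]; last by rewrite set_itv_ge ?bnd_simp -?leNgt// measure0 mule0.
  by rewrite Mk// -EFinM mulrA mulVf ?mul1r ?gt_eqF// EFinB.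
have : (\int[N]_x (f x)%:E = c%:E)%E.
  rewrite -fc; apply: eq_measure_integral => A mA _.
  by first [exact: (esym (NE A mA)) | exact: (NE A mA)].
rewrite ge0_integral_mscale//=; last 2 first.
- exact/measurable_EFinP.
- by move=> x _; rewrite lee_fin.
move=> /(congr1 (fun z => k%:E * z)%E).
by rewrite muleA -!EFinM mulfV ?gt_eqF// mul1e.
Qed.

(* Coordinate by coordinate, half-open interval indicators are replaced by
   arbitrary functions; each step is the uniqueness of Lebesgue measure on [R]. *)
Lemma integral_prod_coord (R : realType) n (lam : {measure set 'rV[R]_n -> \bar R})
    (f : 'I_n -> R -> R) (c : 'I_n -> R) :
  is_lebesgue lam ->
  (forall i, measurable_fun setT (f i)) -> (forall i x, 0 <= f i x) ->
  (forall i, 0 < c i) ->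
  (forall i, \int[lebesgue_measure]_x (f i x)%:E = (c i)%:E)%E ->
  (\int[lam]_x (\prod_i f i (x ord0 i))%:E = (\prod_i c i)%:E)%E.
Proof.
move=> hlam.
(* Induction on the number [k] of leading coordinates that carry arbitrary functions; the others
   still carry interval indicators. The case [k = n] is the goal. *)
have : forall k (f : 'I_n -> R -> R) (c : 'I_n -> R), (k <= n)%N ->
    (forall i : 'I_n, (k <= i)%N -> exists a b, a < b /\ f i = \1_(`]a, b]%classic : set R)) ->
  (forall i, measurable_fun setT (f i)) -> (forall i x, 0 <= f i x) ->
  (forall i, 0 < c i) ->
  (forall i, \int[lebesgue_measure]_x (f i x)%:E = (c i)%:E)%E ->
  (\int[lam]_x (\prod_i f i (x ord0 i))%:E = (\prod_i c i)%:E)%E; last first.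
  by move=> /(_ n f c (leqnn n)); apply => i; rewrite leqNgt ltn_ord.
elim=> [|k IH] {}f {}c kn fk mf f0 c0 fc.
  (* Base case: all factors are interval indicators, so the product is the indicator of a box, whose
     measure [is_lebesgue] prescribes. *)
  have /choice[ab abP] : forall i, exists ab : R * R, ab.1 < ab.2 /\
      f i = \1_(`]ab.1, ab.2]%classic : set R).
    by move=> i; have [a [b ?]] := fk i (leq0n i); exists (a, b).
  pose a : 'rV[R]_n := \row_i (ab i).1; pose b : 'rV[R]_n := \row_i (ab i).2.
  pose B := [set x : 'rV[R]_n | forall i, a ord0 i < x ord0 i <= b ord0 i].
  have fB (x : 'rV[R]_n) : \prod_i f i (x ord0 i) = \1_B x.
    rewrite indicE; have [Bx|Bx] := pselect (B x).
      rewrite mem_set// big1// => i _; rewrite (abP i).2 indicE mem_set//=.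
      by rewrite in_itv/=; have := Bx i; rewrite !mxE.
    rewrite memNset//; move: Bx => /existsNP[i Bxi].
    rewrite (bigD1 i)//= (abP i).2 indicE memNset ?mul0r//=.
    by rewrite in_itv/=; move: Bxi; rewrite !mxE.
  under eq_integral do rewrite fB.
  rewrite integral_indic ?setIT//; last first.
    (* The box is the preimage of [1] under the measurable product. *)
    have mP : measurable_fun setT (fun x : 'rV[R]_n => \prod_i f i (x ord0 i)).
      exact: measurable_prod_coord.
    have := mP measurableT [set 1] (measurable_set1 _); rewrite setTI.
    congr measurable; apply/seteqP; split => x /=; rewrite fB indicE.
      by case: (boolP (x \in B)) => [|_ /eqP]; rewrite ?inE// eq_sym oner_eq0.
    by move=> Bx; rewrite mem_set.
  rewrite hlam; last by move=> i; rewrite !mxE ltW//; exact: (abP i).1.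
  congr (_%:E); apply: eq_bigr => i _; rewrite !mxE.
  have := fc i; rewrite (abP i).2 integral_indic_ocitv; last exact/ltW/(abP i).1.
  by case.
pose j := Ordinal kn.
pose g (x : 'rV[R]_n) := \prod_(i | i != j) f i (x ord0 i).
have mg : measurable_fun setT g by exact: measurable_prod_coord.
have g0 x : 0 <= g x by apply: prodr_ge0.
pose coor (x : 'rV[R]_n) : measurableTypeR R := x ord0 j.
(* [M] is the marginal of [lam] on coordinate [j], weighted by the product of the other factors. The
   induction hypothesis gives its values on intervals and shows that it is a multiple of Lebesgue
   measure. *)
have [M ME'] : exists M : {measure set (measurableTypeR R) -> \bar R},
    forall W : measurableTypeR R -> \bar R,
    measurable_fun setT W -> (forall x, 0 <= W x)%E ->
    (\int[M]_x W x = \int[lam]_x ((g x)%:E * W (coor x)))%E.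
  by apply: weighted_pushforward_measure => //; exact: measurable_coord.
have ME (W : R -> R) : measurable_fun setT W -> (forall x, 0 <= W x) ->
    (\int[M]_x (W x)%:E = \int[lam]_x (g x * W (x ord0 j))%:E)%E.
  by move=> mW W0; rewrite ME'//; exact/measurable_EFinP.
have gf (x : 'rV[R]_n) : \prod_i f i (x ord0 i) = g x * f j (x ord0 j).
  by rewrite (bigD1 j)//= mulrC.
under eq_integral do rewrite gf.
rewrite -(ME (f j))//.
have -> : \prod_i c i = (\prod_(i | i != j) c i) * c j.
  by rewrite (bigD1 j)//= mulrC.
apply: lebesgue_integral_of_ocitv => //.
  by apply: prodr_gt0 => i _; exact: c0.
move=> a b ab.
rewrite -(setIT `]a, b]%classic) -integral_indic// ME//.
pose f' i := if i == j then \1_(`]a, b]%classic : set R) else f i.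
pose c' i := if i == j then b - a else c i.
transitivity (\int[lam]_x (\prod_i f' i (x ord0 i))%:E)%E.
  apply: eq_integral => x _; congr (_%:E).
  rewrite [in RHS](bigD1 j)//= [in RHS]mulrC; congr (_ * _).
    by apply: eq_bigr => i /negbTE ij; rewrite /f' ij.
  by rewrite /f' eqxx.
rewrite (IH f' c') ?(ltnW kn)//.
- rewrite (bigD1 j)//= mulrC; congr (_%:E); congr (_ * _).
    by apply: eq_bigr => i /negbTE ij; rewrite /c' ij.
  by rewrite /c' eqxx.
- move=> i; rewrite leq_eqVlt => /orP[/eqP ki|ki].
    have -> : i = j by apply: val_inj.
    by exists a, b; rewrite /f' eqxx.
  have ij : i != j by apply/eqP => ij; move: ki; rewrite ij /= ltnn.
  by rewrite /f' (negbTE ij); exact: fk.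
- move=> i; rewrite /f'; case: ifP => // _; exact: measurable_indic.
- by move=> i x; rewrite /f'; case: ifP => // _; rewrite indicE.
- by move=> i; rewrite /c'; case: ifP => // _; rewrite subr_gt0.
- move=> i; rewrite /f' /c'; case: ifP => // _.
  by rewrite integral_indic_ocitv// ltW.
Qed.

(** * Gaussian integrals *)

(** Completing the square turns the integrand into a constant times the normal density of mean [m']
    and standard deviation [q^(-1/2)]. A negative [t] is allowed while [q > 0]; the Lyapunov
    estimate takes [t = -1/8]. *)
Lemma integral_normal_pdf_expR_sqr (R : realType) (t m s : R) : 0 < 1 + 2 * t * s ^+ 2 ->
  (\int[lebesgue_measure]_g
     (normal_pdf 0 1 g * expR (- t * (m + s * g) ^+ 2))%:E =
   ((Num.sqrt (1 + 2 * t * s ^+ 2))^-1 *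
     expR (- t * m ^+ 2 / (1 + 2 * t * s ^+ 2)))%:E)%E.
Proof.
set q := 1 + 2 * t * s ^+ 2 => q0; set w := Num.sqrt q.
have w0 : 0 < w by rewrite sqrtr_gt0.
have wV0 : w^-1 != 0 by rewrite invr_neq0// gt_eqF.
have w2 : w ^+ 2 = q by rewrite sqr_sqrtr// ltW.
pose m' := - (2 * t * m * s) / q.
set K := _ * _.
have K0 : 0 <= K by rewrite mulr_ge0 ?expR_ge0// invr_ge0 ltW.
transitivity (\int[lebesgue_measure]_g (K%:E * (normal_pdf m' w^-1 g)%:E))%E.
  apply: eq_integral => g _; rewrite -EFinM; congr (_%:E).
  rewrite !normal_pdfE ?oner_neq0// /normal_peak /normal_fun.
  have -> : Num.sqrt (1 ^+ 2 * pi *+ 2) = w * Num.sqrt (w^-1 ^+ 2 * pi *+ 2) :> R.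
    rewrite -{1}(ger0_norm (ltW w0)) -sqrtr_sqr -sqrtrM ?sqr_ge0//.
    by rewrite expr1n mul1r -mulrnAr mulrA -exprMn mulfV ?gt_eqF// expr1n mul1r.
  rewrite invfM /K.
  set p := (Num.Def.sqrtr _)^-1.
  rewrite -(mulrA (w^-1 * p)) [RHS]mulrACA -!expRD; congr (_ * expR _).
  rewrite exprVn w2 /m' /q.
  by field; rewrite -/q gt_eqF.
by rewrite ge0_integralZl_EFin//= ?integral_normal_pdf ?mule1//;
  [move=> x _; rewrite lee_fin normal_pdf_ge0|
   apply/measurable_EFinP; exact: measurable_normal_pdf].
Qed.

Lemma gauss_densityE (R : realType) n (g : 'rV[R]_n) :
  gauss_density g = \prod_i normal_pdf 0 1 (g ord0 i).
Proof.
under eq_bigr do rewrite normal_pdfE ?oner_neq0// /normal_peak /normal_fun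
  subr0 expr1n mul1r -mulr_natl.
rewrite /gauss_density big_split/= prodr_const card_ord -exprVn -expR_sum; congr (_ * expR _).
by rewrite /sqnorm -mulr_suml sumrN.
Qed.

Lemma measurable_gauss_density (R : realType) n :
  measurable_fun setT (@gauss_density R n).
Proof.
rewrite (_ : @gauss_density R n = fun g => \prod_i normal_pdf 0 1 (g ord0 i)).
  by apply: (measurable_prod_coord predT (f := fun=> normal_pdf 0 1)) => i; exact: measurable_normal_pdf.
by apply/funext => g; rewrite gauss_densityE.
Qed.

Lemma gauss_density_ge0 (R : realType) n (g : 'rV[R]_n) : 0 <= gauss_density g.
Proof. by rewrite gauss_densityE prodr_ge0// => i _; exact: normal_pdf_ge0. Qed.

Lemma integral_gauss_density (R : realType) n (lam : {measure set 'rV[R]_n -> \bar R}) :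
  is_lebesgue lam -> (\int[lam]_g (gauss_density g)%:E = 1)%E.
Proof.
move=> hlam; under eq_integral do rewrite gauss_densityE.
rewrite (@integral_prod_coord _ _ _ (fun=> normal_pdf 0 1) (fun=> 1))//.
- by rewrite big1.
- by move=> i; exact: measurable_normal_pdf.
- by move=> i x; exact: normal_pdf_ge0.
- by move=> i; exact: integral_normal_pdf.
Qed.

(** * The law of the chain *)

Lemma measurable_to_rV (R : realType) d (T : measurableType d) n (F : T -> 'rV[R]_n) :
  (forall i, measurable_fun setT (fun x => F x ord0 i)) -> measurable_fun setT F.
Proof.
move=> mF; apply: (@measurability _ _ _ _ _ _
  (\big[setU/set0]_(i < n) preimage_set_system setT (fun x : 'rV[R]_n => x ord0 i) measurable)) => //.
move=> _ [B + <-].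
elim/big_ind: _ => //.
- by move=> S1 S2 h1 h2 [/h1|/h2].
- by move=> i _ [C mC <-]; rewrite !setTI; have := mF i measurableT C mC; rewrite setTI.
Qed.

Lemma measurable_sqnorm (R : realType) n : measurable_fun setT (@sqnorm R n).
Proof.
apply: measurable_sum => i; apply: measurable_funX; exact: measurable_coord.
Qed.

Lemma mala_accept_01 (R : realType) n h (f : 'rV[R]_n -> R) x y :
  0 <= mala_accept h f x y <= 1.
Proof. by rewrite /mala_accept le_min ler01 expR_ge0 ge_min lexx. Qed.

Lemma measurable_mala_prop (R : realType) n h (f : 'rV[R]_n -> R) :
  (forall i, measurable_fun setT (fun x => grad f x ord0 i)) ->
  measurable_fun setT (fun z : 'rV[R]_n * 'rV[R]_n => mala_prop h f z.1 z.2).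
Proof.
move=> mgrad; apply: measurable_to_rV => i.
rewrite (_ : (fun z => _) = fun z : 'rV[R]_n * 'rV[R]_n =>
  z.1 ord0 i - h * grad f z.1 ord0 i + Num.sqrt (2 * h) * z.2 ord0 i); last first.
  by apply/funext => z; rewrite /mala_prop !mxE.
have mc := @measurable_coord R n i.
apply: measurable_funD.
  apply: measurable_funB; first exact: (measurableT_comp mc measurable_fst).
  by apply: measurable_funM => //; exact: (measurableT_comp (mgrad i) measurable_fst).
by apply: measurable_funM => //; exact: (measurableT_comp mc measurable_snd).
Qed.

Lemma measurable_mala_accept (R : realType) n h (f : 'rV[R]_n -> R) :
  measurable_fun setT f ->
  (forall i, measurable_fun setT (fun x => grad f x ord0 i)) ->
  measurable_fun setT (fun z : 'rV[R]_n * 'rV[R]_n => mala_accept h f z.1 z.2).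
Proof.
move=> mf mgrad.
have mx i : measurable_fun setT (fun z : 'rV[R]_n * 'rV[R]_n => z.1 ord0 i).
  exact: (measurableT_comp (measurable_coord i) measurable_fst).
have my i : measurable_fun setT (fun z : 'rV[R]_n * 'rV[R]_n => z.2 ord0 i).
  exact: (measurableT_comp (measurable_coord i) measurable_snd).
have mgx i : measurable_fun setT (fun z : 'rV[R]_n * 'rV[R]_n => h * grad f z.1 ord0 i).
  by apply: measurable_funM => //; exact: (measurableT_comp (mgrad i) measurable_fst).
have mgy i : measurable_fun setT (fun z : 'rV[R]_n * 'rV[R]_n => h * grad f z.2 ord0 i).
  by apply: measurable_funM => //; exact: (measurableT_comp (mgrad i) measurable_snd).
apply: measurable_minr => //; apply: measurableT_comp => //.
apply: measurable_funD.
  apply: measurable_funB; first exact: (measurableT_comp mf measurable_fst).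
  exact: (measurableT_comp mf measurable_snd).
apply: measurable_funM => //; apply: measurable_funB;
  apply: (measurableT_comp (@measurable_sqnorm R n)); apply: measurable_to_rV => i.
- rewrite (_ : (fun z => _) = fun z : 'rV[R]_n * 'rV[R]_n =>
    z.2 ord0 i - z.1 ord0 i + h * grad f z.1 ord0 i).
    by apply: measurable_funD => //; exact: measurable_funB.
  by apply/funext => z; rewrite !mxE.
- rewrite (_ : (fun z => _) = fun z : 'rV[R]_n * 'rV[R]_n =>
    z.1 ord0 i - z.2 ord0 i + h * grad f z.2 ord0 i).
    by apply: measurable_funD => //; exact: measurable_funB.
  by apply/funext => z; rewrite !mxE.
Qed.

(** Turning the proposal noise into a probability [G] makes the product [P \x G] and Tonelli's
    theorem available for one step of the chain. *)
Lemma gauss_probability (R : realType) n (lam : {measure set 'rV[R]_n -> \bar R}) :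
  is_lebesgue lam ->
  exists G : probability 'rV[R]_n R, forall W : 'rV[R]_n -> \bar R,
    measurable_fun setT W -> (forall x, 0 <= W x)%E ->
    (\int[G]_g W g = \int[lam]_g ((gauss_density g)%:E * W g))%E.
Proof.
move=> hlam.
have [m mE] := density_measure lam (@measurable_gauss_density R n) (@gauss_density_ge0 R n).
have m1 : m setT = 1%E.
  rewrite -(integral_gauss_density hlam) -(mul1e (m setT)) -integral_cst// mE//.
  by apply: eq_integral => x _; rewrite mule1.
have [G GE] := probability_of_measure m1.
exists G => W mW W0; rewrite -mE//.
by apply: eq_measure_integral => A _ _; exact: GE.
Qed.

(** The rejection mass [1 - \int a] becomes [\int (1 - a)] under [G], so that the kernel is a sum of
    integrals of nonnegative functions. *)
Lemma mala_kernelE (R : realType) n (lam G : {measure set 'rV[R]_n -> \bar R}) h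
    (f : 'rV[R]_n -> R) x A :
  measurable_fun setT f ->
  (forall i, measurable_fun setT (fun x => grad f x ord0 i)) ->
  G setT = 1%E ->
  (forall W : 'rV[R]_n -> \bar R,
    measurable_fun setT W -> (forall x, 0 <= W x)%E ->
    (\int[G]_g W g = \int[lam]_g ((gauss_density g)%:E * W g))%E) ->
  measurable A ->
  mala_kernel lam h f x A =
  (\int[G]_g (mala_accept h f x (mala_prop h f x g) * \1_A (mala_prop h f x g))%:E +
   \int[G]_g ((1 - mala_accept h f x (mala_prop h f x g)) * \1_A x)%:E)%E.
Proof.
move=> mf mgrad G1 GE mA; rewrite /mala_kernel.
pose y g := mala_prop h f x g; pose a g := mala_accept h f x (y g).
have my : measurable_fun setT y by exact: (measurable_fun_pair2 x (measurable_mala_prop h mgrad)).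
have ma : measurable_fun setT a.
  pose A2 (z : 'rV[R]_n * 'rV[R]_n) := mala_accept h f z.1 z.2.
  have mA2 : measurable_fun setT A2 by exact: measurable_mala_accept.
  have mxy : measurable_fun setT (fun g => (x, y g)) by exact: measurable_fun_pair.
  exact: (measurableT_comp mA2 mxy).
have a01 g : 0 <= a g <= 1 by exact: mala_accept_01.
have a0 g : 0 <= a g by case/andP: (a01 g).
have a1 g : 0 <= 1 - a g by rewrite subr_ge0; case/andP: (a01 g).
change (\int[lam]_g (gauss_density g * a g * \1_A (y g))%:E +
  (1 - \int[lam]_g (gauss_density g * a g)%:E) * (\1_A x)%:E =
  \int[G]_g (a g * \1_A (y g))%:E + \int[G]_g ((1 - a g) * \1_A x)%:E)%E.
clearbody a; clearbody y.
congr (_ + _)%E.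
  rewrite GE; last 2 first.
  - apply/measurable_EFinP; apply: measurable_funM => //.
    by apply: measurableT_comp => //; exact: measurable_indic.
  - by move=> g; rewrite lee_fin mulr_ge0// indicE.
  by apply: eq_integral => g _; rewrite -EFinM mulrA.
have -> : (\int[lam]_g (gauss_density g * a g)%:E = \int[G]_g (a g)%:E)%E.
  by rewrite GE//; exact/measurable_EFinP.
have mEa : measurable_fun setT (fun g => (a g)%:E) by exact/measurable_EFinP.
have mE1a : measurable_fun setT (fun g => (1 - a g)%:E).
  by apply/measurable_EFinP; exact: measurable_funB.
under [in RHS]eq_integral do rewrite EFinM.
rewrite ge0_integralZr//; last by move=> g _; rewrite lee_fin.
congr (_ * _)%E.
have Gs : (\int[G]_g (a g)%:E + \int[G]_g (1 - a g)%:E = 1)%E.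
  rewrite -ge0_integralD//; last 2 first.
  - by move=> g _; rewrite lee_fin.
  - by move=> g _; rewrite lee_fin.
  under eq_integral do rewrite -EFinD addrC subrK.
  by rewrite integral_cst// mul1e.
have Gfin : (\int[G]_g (a g)%:E)%E \is a fin_num.
  rewrite ge0_fin_numE; last by apply: integral_ge0 => g _; rewrite lee_fin.
  rewrite (@le_lt_trans _ _ 1%E) ?ltry// -Gs leeDl//.
  by apply: integral_ge0 => g _; rewrite lee_fin.
by rewrite -Gs addeAC subee// add0e.
Qed.

(** The new law is a sum of two weighted images of [P \x G]: the accepted mass, of weight [a],
    carried along the proposal, and the rejected mass, of weight [1 - a], carried along the first
    projection. The weights add up to one, so it is again a probability. *)
Lemma mala_step (R : realType) n (lam : {measure set 'rV[R]_n -> \bar R})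
    (G P : probability 'rV[R]_n R) h (f : 'rV[R]_n -> R) :
  measurable_fun setT f ->
  (forall i, measurable_fun setT (fun x => grad f x ord0 i)) ->
  (forall W : 'rV[R]_n -> \bar R,
    measurable_fun setT W -> (forall x, 0 <= W x)%E ->
    (\int[G]_g W g = \int[lam]_g ((gauss_density g)%:E * W g))%E) ->
  exists Q : probability 'rV[R]_n R,
    (forall A, measurable A -> (\int[P]_x mala_kernel lam h f x A = Q A)%E) /\
    (forall W : 'rV[R]_n -> R, measurable_fun setT W -> (forall x, 0 <= W x) ->
      (\int[Q]_x (W x)%:E = \int[P]_x \int[G]_g
         (mala_accept h f x (mala_prop h f x g) * W (mala_prop h f x g) +
          (1 - mala_accept h f x (mala_prop h f x g)) * W x)%:E)%E).
Proof.
move=> mf mgrad GE.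
pose V : measurableType _ := 'rV[R]_n.
pose phi (z : V * V) := mala_prop h f z.1 z.2.
pose a (z : V * V) := mala_accept h f z.1 (phi z).
have mphi : measurable_fun setT phi by exact: measurable_mala_prop.
have ma : measurable_fun setT a.
  pose A2 (z : V * V) := mala_accept h f z.1 z.2.
  have mA2 : measurable_fun setT A2 by exact: measurable_mala_accept.
  have mxy : measurable_fun setT (fun z => (z.1, phi z)) by exact: measurable_fun_pair.
  exact: (measurableT_comp mA2 mxy).
have a0 z : 0 <= a z by case/andP: (mala_accept_01 h f z.1 (phi z)).
have a1 z : 0 <= 1 - a z by rewrite subr_ge0; case/andP: (mala_accept_01 h f z.1 (phi z)).
have m1a : measurable_fun setT (fun z => 1 - a z) by exact: measurable_funB.
have kE x A : measurable A -> mala_kernel lam h f x A =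
    (\int[G]_g (a (x, g) * \1_A (phi (x, g)))%:E +
     \int[G]_g ((1 - a (x, g)) * \1_A x)%:E)%E.
  by move=> mA; rewrite (mala_kernelE _ _ mf mgrad _ GE)//; exact: probability_setT.
suff [Q [QA QW]] : exists Q : probability 'rV[R]_n R,
    (forall A, measurable A -> (\int[P]_x mala_kernel lam h f x A = Q A)%E) /\
    (forall W : 'rV[R]_n -> R, measurable_fun setT W -> (forall x, 0 <= W x) ->
      (\int[Q]_x (W x)%:E = \int[P]_x \int[G]_g
         (a (x, g) * W (phi (x, g)) + (1 - a (x, g)) * W x)%:E)%E).
  by exists Q.
clearbody a phi.
have [M1 M1E] := weighted_pushforward_measure (P \x G)%E ma a0 mphi.
have [M2 M2E] := weighted_pushforward_measure (P \x G)%E m1a a1 measurable_fst.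
pose M : {measure set V -> \bar R} := measure_add M1 M2.
have MW (W : V -> R) : measurable_fun setT W -> (forall x, 0 <= W x) ->
   (\int[M]_x (W x)%:E = \int[P]_x \int[G]_g
         (a (x, g) * W (phi (x, g)) + (1 - a (x, g)) * W x)%:E)%E.
  move=> mW W0.
  have mEW : measurable_fun setT (fun x => (W x)%:E) by exact/measurable_EFinP.
  rewrite ge0_integral_measure_add//.
  have mw1 : measurable_fun setT (fun z => a z * W (phi z)).
    by apply: measurable_funM => //; exact: measurableT_comp.
  have mw2 : measurable_fun setT (fun z : V * V => (1 - a z) * W z.1).
    by apply: measurable_funM => //; exact: measurableT_comp.
  rewrite M1E//.
  rewrite M2E//.
  rewrite -ge0_integralD//; last 4 first.
  - by move=> z _; rewrite -EFinM lee_fin mulr_ge0.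
  - by under eq_fun do rewrite -EFinM; exact/measurable_EFinP.
  - by move=> z _; rewrite -EFinM lee_fin mulr_ge0.
  - by under eq_fun do rewrite -EFinM; exact/measurable_EFinP.
  rewrite (fubini_tonelli1 (fun z : V * V => ((a z)%:E * (W (phi z))%:E + (1 - a z)%:E * (W z.1)%:E)%E))//.
    under eq_fun do rewrite -!EFinM -EFinD.
    by apply/measurable_EFinP; exact: measurable_funD.
  by move=> z; rewrite -!EFinM -EFinD lee_fin addr_ge0// mulr_ge0.
  by move=> x _; rewrite lee_fin.
have MT : M setT = 1%E.
  rewrite -(mul1e (M setT)) -integral_cst// MW//.
  have G1 : G setT = 1%E by exact: probability_setT.
  have P1 : P setT = 1%E by exact: probability_setT.
  transitivity (\int[P]_x cst 1%E x)%E.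
    apply: eq_integral => x _.
    under eq_integral do rewrite !mulr1 addrC subrK.
    by rewrite integral_cst// mul1e.
  by rewrite integral_cst// mul1e.
have [Q QM] := probability_of_measure MT.
exists Q; split=> [A mA|W mW W0]; last first.
  rewrite -MW//; apply: eq_measure_integral => A _ _; exact: QM.
rewrite QM -(setIT A) -integral_indic// MW//.
apply: eq_integral => x _; rewrite setIT kE//.
rewrite -ge0_integralD//; last 4 first.
- by move=> g _; rewrite lee_fin mulr_ge0// indicE.
- apply/measurable_EFinP; apply: measurable_funM.
    exact: (measurable_fun_pair2 x ma).
  by apply: measurableT_comp; [exact: measurable_indic|exact: (measurable_fun_pair2 x mphi)].
- by move=> g _; rewrite lee_fin mulr_ge0// indicE.
- apply/measurable_EFinP; apply: measurable_funM => //.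
  exact: (measurable_fun_pair2 x m1a).
Qed.

Lemma integral_mala_accept_le1 (R : realType) n (lam : {measure set 'rV[R]_n -> \bar R})
    h (f : 'rV[R]_n -> R) x (y : 'rV[R]_n -> 'rV[R]_n) : is_lebesgue lam ->
  (\int[lam]_g (gauss_density g * mala_accept h f x (y g))%:E <= 1)%E.
Proof.
move=> hlam; rewrite -(integral_gauss_density hlam); apply: ge0_le_integralT => g.
  by rewrite lee_fin mulr_ge0 ?gauss_density_ge0//; case/andP: (mala_accept_01 h f x (y g)).
rewrite lee_fin ler_piMr ?gauss_density_ge0//.
by case/andP: (mala_accept_01 h f x (y g)).
Qed.

(** From a point of [Om] the proposal is rejected with probability at least [1 - e], and a rejected
    move stays in [Om]; so each step keeps at least that fraction of the mass. *)
Lemma mala_law_stay (R : realType) n (lam : {measure set 'rV[R]_n -> \bar R})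
    h (f : 'rV[R]_n -> R) (pi0 : probability 'rV[R]_n R) (Om : set 'rV[R]_n) (e : R) T :
  is_lebesgue lam -> measurable_fun setT f ->
  (forall i, measurable_fun setT (fun x => grad f x ord0 i)) ->
  measurable Om -> pi0 Om = 1%E -> 0 <= e <= 1 ->
  (forall x, Om x -> \int[lam]_g (gauss_density g *
     mala_accept h f x (mala_prop h f x g))%:E <= e%:E)%E ->
  (((1 - e) ^+ T)%:E <= mala_law lam h f pi0 T Om)%E.
Proof.
move=> hlam mf mgrad mOm pi0Om /andP[e0 e1] He.
have [G GE] := gauss_probability hlam.
(* The induction carries a genuine probability that agrees with the law on measurable sets. *)
suff [Q [QE]] : exists Q : probability 'rV[R]_n R,
    (forall A, measurable A -> mala_law lam h f pi0 T A = Q A) /\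
    (((1 - e) ^+ T)%:E <= Q Om)%E by rewrite QE.
elim: T => [|T [Q [QE QOm]]].
  by exists pi0; split=> //; rewrite pi0Om.
have [Q' [Q'A _]] := mala_step Q h mf mgrad GE.
exists Q'; split=> [A mA|].
  by rewrite -Q'A//=; exact: eq_integral_on_measurable.
rewrite -Q'A// (@le_trans _ _ (\int[Q]_x ((1 - e)%:E * (\1_Om x)%:E))%E)//.
  have m1 : measurable_fun setT (fun x => (\1_Om x)%:E : \bar R).
    by apply/measurable_EFinP; exact: measurable_indic.
  rewrite ge0_integralZl_EFin ?subr_ge0//.
  rewrite integral_indic// setIT exprS EFinM.
  by apply: lee_wpmul2l => //; rewrite lee_fin subr_ge0.
apply: ge0_le_integralT => x.
  by rewrite -EFinM lee_fin mulr_ge0 ?subr_ge0// indicE.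
rewrite /mala_kernel.
have I1 := integral_mala_accept_le1 h f x (mala_prop h f x) hlam.
have I0 : (0 <= \int[lam]_g (gauss_density g *
     mala_accept h f x (mala_prop h f x g))%:E)%E.
  apply: integral_ge0 => g _; rewrite lee_fin mulr_ge0 ?gauss_density_ge0//.
  by case/andP: (mala_accept_01 h f x (mala_prop h f x g)).
(* Only the rejected mass is kept; the accepted moves add a nonnegative term. *)
apply: (@le_trans _ _ ((1 - \int[lam]_g (gauss_density g *
     mala_accept h f x (mala_prop h f x g))%:E) * (\1_Om x)%:E))%E; last first.
  rewrite leeDr//; apply: integral_ge0 => g _; rewrite lee_fin !mulr_ge0 ?gauss_density_ge0 ?indicE//.
  by case/andP: (mala_accept_01 h f x (mala_prop h f x g)).
have [Ox|Ox] := boolP (x \in Om); last by rewrite indicE (negbTE Ox) !mule0.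
rewrite indicE Ox !mule1 EFinB leeB//.
by apply: He; rewrite inE in Ox.
Qed.

(** A Lyapunov argument: the mean of [V] grows by a factor of at most [r] per step. The law is
    handed over as a probability [Q] so that Markov's inequality and complements can be used on
    it. *)
Lemma mala_law_drift (R : realType) n (lam : {measure set 'rV[R]_n -> \bar R})
    h (f : 'rV[R]_n -> R) (pi0 : probability 'rV[R]_n R) (V : 'rV[R]_n -> R) (r : R) T :
  is_lebesgue lam -> measurable_fun setT f ->
  (forall i, measurable_fun setT (fun x => grad f x ord0 i)) ->
  measurable_fun setT V -> (forall x, 0 <= V x) -> 0 <= r ->
  (forall x, \int[lam]_g (gauss_density g *
     (mala_accept h f x (mala_prop h f x g) * V (mala_prop h f x g) +
      (1 - mala_accept h f x (mala_prop h f x g)) * V x))%:E <= (r * V x)%:E)%E ->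
  exists Q : probability 'rV[R]_n R,
    (forall A, measurable A -> mala_law lam h f pi0 T A = Q A) /\
    (\int[Q]_x (V x)%:E <= (r ^+ T)%:E * \int[pi0]_x (V x)%:E)%E.
Proof.
move=> hlam mf mgrad mV V0 r0 HV.
have [G GE] := gauss_probability hlam.
elim: T => [|T [Q [QE QV]]].
  by exists pi0; split=> //; rewrite expr0 mul1e.
have [Q' [Q'A Q'V]] := mala_step Q h mf mgrad GE.
exists Q'; split=> [A mA|].
  by rewrite -Q'A//=; exact: eq_integral_on_measurable.
rewrite Q'V// exprS EFinM -muleA (@le_trans _ _ (r%:E * \int[Q]_x (V x)%:E)%E)//; last first.
  by apply: lee_wpmul2l; rewrite ?lee_fin.
have mEV : measurable_fun setT (fun x => (V x)%:E) by exact/measurable_EFinP.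
rewrite -ge0_integralZl_EFin//; last by move=> x _; rewrite lee_fin.
have a01 x g : 0 <= mala_accept h f x g <= 1 by exact: mala_accept_01.
have ge0 x g : 0 <= mala_accept h f x (mala_prop h f x g) * V (mala_prop h f x g) +
      (1 - mala_accept h f x (mala_prop h f x g)) * V x.
  by have /andP[? ?] := a01 x (mala_prop h f x g); rewrite addr_ge0// mulr_ge0// subr_ge0.
apply: ge0_le_integralT => x.
  by apply: integral_ge0 => g _; rewrite lee_fin.
rewrite GE; first exact: HV.
have mp : measurable_fun setT (fun g => mala_prop h f x g).
  exact: (measurable_fun_pair2 x (measurable_mala_prop h mgrad)).
have ma : measurable_fun setT (fun g => mala_accept h f x (mala_prop h f x g)).
  pose A2 (z : 'rV[R]_n * 'rV[R]_n) := mala_accept h f z.1 z.2.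
  have mA2 : measurable_fun setT A2 by exact: measurable_mala_accept.
  have mxy : measurable_fun setT (fun g => (x, mala_prop h f x g)) by exact: measurable_fun_pair.
  exact: (measurableT_comp mA2 mxy).
  apply/measurable_EFinP; apply: measurable_funD; apply: measurable_funM => //.
    exact: (measurableT_comp mV mp).
  exact: measurable_funB.
by move=> g; rewrite lee_fin.
Qed.

Lemma le_tv_dist (R : realType) n (mu nu : set 'rV[R]_n -> \bar R) A :
  measurable A -> (`|mu A - nu A| <= tv_dist mu nu)%E.
Proof. by move=> mA; apply: ereal_sup_ubound; exists A. Qed.

(** * Separable potentials *)

Definition separable (R : realType) n (phi : 'I_n -> R -> R) (x : 'rV[R]_n) : R :=
  \sum_i phi i (x ord0 i).

Lemma derive_coord (R : realType) n (phi : R -> R) (x v : 'rV[R]_n) i :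
  'D_v (fun y : 'rV[R]_n => phi (y ord0 i)) x = 'D_(v ord0 i) phi (x ord0 i).
Proof.
rewrite /derive /=; apply: congr1; apply: (congr1 (fun F => F @ 0^')).
by apply/funext => t /=; rewrite !mxE.
Qed.

Lemma differentiable_of_coord (R : realType) n (phi dphi : R -> R) (x : 'rV[R]_n) i :
  (forall t : R, is_derive t 1 phi (dphi t)) ->
  differentiable (fun y : 'rV[R]_n => phi (y ord0 i)) x.
Proof.
move=> Hphi; pose c (y : 'rV[R]_n) : R := y ord0 i.
change (differentiable (phi \o c) x); apply: differentiable_comp.
  exact: differentiable_coord.
by apply/derivable1_diffP; exact: ex_derive.
Qed.

Lemma derive_ev_coord (R : realType) n (phi dphi : R -> R) (x : 'rV[R]_n) i j :
  (forall t : R, is_derive t 1 phi (dphi t)) ->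
  'D_(ev j) (fun y : 'rV[R]_n => phi (y ord0 i)) x = (i == j)%:R * dphi (x ord0 i).
Proof.
move=> Hphi; rewrite derive_coord /ev mxE eqxx /=.
case: (i == j); last by rewrite derive0 mul0r.
by rewrite mul1r derive_val.
Qed.

Lemma separableE (R : realType) n (phi : 'I_n -> R -> R) :
  separable phi = \sum_i (fun y : 'rV[R]_n => phi i (y ord0 i)).
Proof. by apply/funext => x; rewrite fct_sumE. Qed.

Lemma differentiable_separable (R : realType) n (phi dphi : 'I_n -> R -> R) x :
  (forall i (t : R), is_derive t 1 (phi i) (dphi i t)) -> differentiable (separable phi) x.
Proof.
move=> Hphi; rewrite separableE; apply: differentiable_sum => i.
exact: differentiable_of_coord (Hphi i).
Qed.

Lemma derive_ev_separable (R : realType) n (phi dphi : 'I_n -> R -> R) x j :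
  (forall i (t : R), is_derive t 1 (phi i) (dphi i t)) ->
  'D_(ev j) (separable phi) x = dphi j (x ord0 j).
Proof.
move=> Hphi; rewrite separableE derive_sum; last first.
  by move=> i; apply: diff_derivable; exact: differentiable_of_coord (Hphi i).
under eq_bigr do rewrite (derive_ev_coord _ _ _ (Hphi _)).
rewrite (bigD1 j)//= eqxx mul1r big1 ?addr0// => i /negbTE ->.
by rewrite mul0r.
Qed.

Lemma grad_separable (R : realType) n (phi dphi : 'I_n -> R -> R) x :
  (forall i (t : R), is_derive t 1 (phi i) (dphi i t)) ->
  grad (separable phi) x = \row_i dphi i (x ord0 i).
Proof.
by move=> Hphi; apply/rowP => i; rewrite !mxE (derive_ev_separable _ _ Hphi).
Qed.

Lemma twice_differentiable_separable (R : realType) n (phi dphi ddphi : 'I_n -> R -> R) :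
  (forall i (t : R), is_derive t 1 (phi i) (dphi i t)) ->
  (forall i (t : R), is_derive t 1 (dphi i) (ddphi i t)) ->
  twice_differentiable (separable phi).
Proof.
move=> Hphi Hdphi; split=> [x|i x]; first exact: differentiable_separable.
rewrite (_ : (fun y => _) = fun y : 'rV[R]_n => dphi i (y ord0 i)).
  exact: differentiable_of_coord (Hdphi i).
by apply/funext => y; exact: derive_ev_separable.
Qed.

(** The Hessian is diagonal, so bounds on the second derivatives of the coordinate functions are
    bounds on its quadratic form. *)
Lemma hessian_bounded_separable (R : realType) n (phi dphi ddphi : 'I_n -> R -> R) k :
  (forall i (t : R), is_derive t 1 (phi i) (dphi i t)) ->
  (forall i (t : R), is_derive t 1 (dphi i) (ddphi i t)) ->
  (forall i t, 1 <= ddphi i t <= k) ->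
  hessian_bounded (separable phi) k.
Proof.
move=> Hphi Hdphi Hdd x v.
have D1 i : (fun y : 'rV[R]_n => 'D_(ev i) (separable phi) y) =
    fun y : 'rV[R]_n => dphi i (y ord0 i).
  by apply/funext => y; exact: derive_ev_separable.
have -> : quadform (hess (separable phi) x) v = \sum_i ddphi i (x ord0 i) * v ord0 i ^+ 2.
  apply: eq_bigr => i _.
  rewrite (bigD1 i)//= big1 ?addr0 => [|j /negbTE ji];
    rewrite mxE D1 (derive_ev_coord _ _ _ (Hdphi i)).
    by rewrite eqxx mul1r; ring.
  by rewrite eq_sym ji mul0r mulr0 mul0r.
rewrite /sqnorm mulr_sumr; apply/andP; split; apply: ler_sum => i _.
  by rewrite ler_peMl ?sqr_ge0//; case/andP: (Hdd i (x ord0 i)).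
by rewrite ler_wpM2r ?sqr_ge0//; case/andP: (Hdd i (x ord0 i)).
Qed.

Lemma measurable_of_is_derive (R : realType) (phi dphi : R -> R) :
  (forall t : R, is_derive t 1 phi (dphi t)) -> measurable_fun setT phi.
Proof.
move=> Hphi; apply: continuous_measurable_fun => t.
by apply: differentiable_continuous; apply/derivable1_diffP; exact: ex_derive.
Qed.

Lemma measurable_separable (R : realType) n (phi dphi : 'I_n -> R -> R) :
  (forall i (t : R), is_derive t 1 (phi i) (dphi i t)) ->
  measurable_fun setT (separable phi).
Proof.
move=> Hphi; apply: measurable_sum => i.
exact: (measurableT_comp (measurable_of_is_derive (Hphi i)) (measurable_coord i)).
Qed.

Lemma measurable_grad_separable (R : realType) n (phi dphi ddphi : 'I_n -> R -> R) :
  (forall i (t : R), is_derive t 1 (phi i) (dphi i t)) ->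
  (forall i (t : R), is_derive t 1 (dphi i) (ddphi i t)) ->
  forall i, measurable_fun setT (fun x => grad (separable phi) x ord0 i).
Proof.
move=> Hphi Hdphi i; rewrite (_ : (fun x => _) = fun x : 'rV[R]_n => dphi i (x ord0 i)).
  exact: (measurableT_comp (measurable_of_is_derive (Hdphi i)) (measurable_coord i)).
by apply/funext => x; rewrite (grad_separable _ Hphi) mxE.
Qed.

(** Expanded, this is the trapezoidal error [phi x - phi y + (y - x) (dphi x + dphi y) / 2] plus the
    gradient term [h (dphi x ^ 2 - dphi y ^ 2) / 4]. *)
Definition log_accept1 (R : realType) (h : R) (phi dphi : R -> R) (x y : R) : R :=
  phi x - phi y + (4 * h)^-1 *
    ((y - x + h * dphi x) ^+ 2 - (x - y + h * dphi y) ^+ 2).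

Lemma mala_accept_separable (R : realType) n (phi dphi : 'I_n -> R -> R) h (x y : 'rV[R]_n) :
  (forall i (t : R), is_derive t 1 (phi i) (dphi i t)) ->
  mala_accept h (separable phi) x y =
  Num.min 1 (expR (\sum_i log_accept1 h (phi i) (dphi i) (x ord0 i) (y ord0 i))).
Proof.
move=> Hphi; rewrite /mala_accept !(grad_separable _ Hphi); congr (Num.min 1 (expR _)).
rewrite /log_accept1 big_split/= -mulr_sumr !sumrB; congr (_ + _ * (_ - _));
  by apply: eq_bigr => i _; rewrite !mxE.
Qed.

Lemma mala_prop_separable (R : realType) n (phi dphi : 'I_n -> R -> R) h (x g : 'rV[R]_n) i :
  (forall i (t : R), is_derive t 1 (phi i) (dphi i t)) ->
  mala_prop h (separable phi) x g ord0 i =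
  x ord0 i - h * dphi i (x ord0 i) + Num.sqrt (2 * h) * g ord0 i.
Proof. by move=> Hphi; rewrite /mala_prop (grad_separable _ Hphi) !mxE. Qed.

(* [b i] dominates the exponentiated one-dimensional log-acceptance ratio; the
   product structure of the proposal multiplies the expectations. *)
Lemma integral_mala_accept_separable (R : realType) n
    (lam : {measure set 'rV[R]_n -> \bar R}) (phi dphi : 'I_n -> R -> R) h (x : 'rV[R]_n)
    (b : 'I_n -> R -> R) (c : 'I_n -> R) :
  is_lebesgue lam -> (forall i (t : R), is_derive t 1 (phi i) (dphi i t)) ->
  (forall i, measurable_fun setT (b i)) ->
  (forall i t, expR (log_accept1 h (phi i) (dphi i) (x ord0 i)
     (x ord0 i - h * dphi i (x ord0 i) + Num.sqrt (2 * h) * t)) <= b i t) ->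
  (forall i, 0 < c i) ->
  (forall i, \int[lebesgue_measure]_t (normal_pdf 0 1 t * b i t)%:E = (c i)%:E)%E ->
  (\int[lam]_g (gauss_density g * mala_accept h (separable phi) x
     (mala_prop h (separable phi) x g))%:E <= (\prod_i c i)%:E)%E.
Proof.
move=> hlam Hphi mb Hb c0 Hc.
have b0 i t : 0 <= b i t by apply: le_trans (Hb i t); exact: expR_ge0.
rewrite -(@integral_prod_coord _ _ lam (fun i t => normal_pdf 0 1 t * b i t) c)//; last 2 first.
- by move=> i; apply: measurable_funM => //; exact: measurable_normal_pdf.
- by move=> i t; rewrite mulr_ge0// normal_pdf_ge0.
apply: ge0_le_integralT => g.
  rewrite lee_fin mulr_ge0 ?gauss_density_ge0//.
  by case/andP: (mala_accept_01 h (separable phi) x (mala_prop h (separable phi) x g)).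
rewrite lee_fin big_split/= -gauss_densityE ler_wpM2l ?gauss_density_ge0//.
(* The truncation at [1] is dropped, because only the exponential factors over the coordinates. *)
rewrite (mala_accept_separable _ _ _ Hphi) ge_min; apply/orP; right.
rewrite expR_sum; apply: ler_prod => i _; rewrite expR_ge0/=.
by rewrite (mala_prop_separable _ _ _ _ Hphi).
Qed.

Lemma measurable_box (R : realType) n (B : 'I_n -> set R) :
  (forall i, measurable (B i)) -> measurable [set x : 'rV[R]_n | forall i, B i (x ord0 i)].
Proof.
move=> mB.
rewrite (_ : [set x | _] = \bigcap_(i in [set: 'I_n]) [set x : 'rV[R]_n | B i (x ord0 i)]).
  apply: fin_bigcap_measurable => // i _.
  have := @measurable_coord R n i measurableT (B i) (mB i).
  by rewrite setTI.
by apply/seteqP; split => x /= Bx i; [move=> _|]; exact: Bx.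
Qed.

(** Window masses and exponential moments of [sqnorm] are both integrals of products over
    coordinates, so one product formula, with a normalizing constant per coordinate, yields them
    all. *)
Lemma target_probability (R : realType) n (lam : {measure set 'rV[R]_n -> \bar R})
    (phi : 'I_n -> R -> R) (Z : 'I_n -> R) :
  is_lebesgue lam -> (forall i, measurable_fun setT (phi i)) ->
  (forall i, 0 < Z i) ->
  (forall i, \int[lebesgue_measure]_t (expR (- phi i t))%:E = (Z i)%:E)%E ->
  exists P : probability 'rV[R]_n R,
    (forall A, measurable A -> target lam (separable phi) A = P A) /\
    (forall (b : 'I_n -> R -> R) (c : 'I_n -> R), (forall i, measurable_fun setT (b i)) -> (forall i t, 0 <= b i t) ->
      (forall i, 0 < c i) ->
      (forall i, \int[lebesgue_measure]_t (expR (- phi i t) * b i t)%:E = (c i)%:E)%E ->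
      (\int[P]_x (\prod_i b i (x ord0 i))%:E = (\prod_i (c i / Z i))%:E)%E).
Proof.
move=> hlam mphi Z0 HZ.
have expE (x : 'rV[R]_n) : expR (- separable phi x) = \prod_i expR (- phi i (x ord0 i)).
  by rewrite /separable -sumrN expR_sum.
have mexp i : measurable_fun setT (fun t => expR (- phi i t)).
  by apply: measurableT_comp => //; exact: measurable_funN.
have ZE : fine (\int[lam]_x (expR (- separable phi x))%:E) = \prod_i Z i.
  under eq_integral do rewrite expE.
  rewrite (@integral_prod_coord _ _ lam (fun i t => expR (- phi i t)) Z)//.
have ZV0 : 0 < \prod_i Z i by apply: prodr_gt0.
pose rho (x : 'rV[R]_n) := expR (- separable phi x) / \prod_i Z i.
have mrho : measurable_fun setT rho.
  apply: measurable_funM => //.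
  rewrite (_ : (fun x => _) = fun x : 'rV[R]_n => \prod_i expR (- phi i (x ord0 i))).
    exact: (measurable_prod_coord predT mexp).
  by apply/funext => x; rewrite expE.
have rho0 x : 0 <= rho x by rewrite divr_ge0 ?expR_ge0// ltW.
have [m mE] := density_measure lam mrho rho0.
have mprod (b : 'I_n -> R -> R) (c : 'I_n -> R) : (forall i, measurable_fun setT (b i)) -> (forall i t, 0 <= b i t) ->
      (forall i, 0 < c i) ->
      (forall i, \int[lebesgue_measure]_t (expR (- phi i t) * b i t)%:E = (c i)%:E)%E ->
      (\int[m]_x (\prod_i b i (x ord0 i))%:E = (\prod_i (c i / Z i))%:E)%E.
  move=> mb b0 c0 Hc.
  have mpb : measurable_fun setT (fun x : 'rV[R]_n => (\prod_i b i (x ord0 i))%:E).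
    by apply/measurable_EFinP; exact: measurable_prod_coord.
  have pb0 (x : 'rV[R]_n) : 0 <= \prod_i b i (x ord0 i) by rewrite prodr_ge0.
  rewrite mE//.
  transitivity (\int[lam]_x ((\prod_i (Z i))^-1%:E *
     (\prod_i (expR (- phi i (x ord0 i)) * b i (x ord0 i)))%:E))%E.
    apply: eq_integral => x _; rewrite -!EFinM; congr (_%:E).
    by rewrite /rho expE big_split/=; ring.
  have mebi i : measurable_fun setT (fun t => expR (- phi i t) * b i t).
    exact: measurable_funM.
  rewrite ge0_integralZl_EFin//; last 3 first.
  - by move=> x _; rewrite lee_fin prodr_ge0// => i _; rewrite mulr_ge0// expR_ge0.
  - by apply/measurable_EFinP; exact: (measurable_prod_coord predT mebi).
  - by rewrite invr_ge0 ltW.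
  rewrite (@integral_prod_coord _ _ lam (fun i t => expR (- phi i t) * b i t) c)//.
    by rewrite -EFinM big_split/= mulrC prodfV.
  by move=> i t; rewrite mulr_ge0// expR_ge0.
have m1 : m setT = 1%E.
  rewrite -(mul1e (m setT)) -integral_cst//.
  have := mprod (fun=> cst 1) Z; under eq_integral do rewrite big1//.
  move=> ->//.
    by rewrite big1// => i _; rewrite divff// gt_eqF.
  by move=> i; under eq_integral do rewrite mulr1; exact: HZ.
have [P PE] := probability_of_measure m1.
exists P; split=> [A mA|b c mb b0 c0 Hc].
  transitivity (\int[m]_x (\1_A x)%:E)%E; last first.
    by rewrite integral_indic// setIT -PE.
  have mA1 : measurable_fun setT (fun x : 'rV[R]_n => (\1_A x)%:E : \bar R).
    by apply/measurable_EFinP; exact: measurable_indic.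
  rewrite mE// /target ZE (integral_mkcond A); apply: eq_integral => x _.
  by rewrite epatch_indic.
rewrite -(mprod b c)//; apply: eq_measure_integral => A _ _; exact: PE.
Qed.

(** * Warm starts and confinement to a window *)

(** The start is the target conditioned on [Om]: its density is [1 / p] on [Om] and zero elsewhere,
    so the warmness is the inverse of the target mass of [Om]. *)
Lemma warm_start (R : realType) n (mu : set 'rV[R]_n -> \bar R)
    (P : probability 'rV[R]_n R) (Om : set 'rV[R]_n) (p M : R) :
  (forall A, measurable A -> mu A = P A) -> measurable Om ->
  P Om = p%:E -> 0 < p -> p^-1 <= M ->
  exists pi0 : probability 'rV[R]_n R, [/\ density_bounded mu pi0 M, pi0 Om = 1%E &
    forall (V : 'rV[R]_n -> R) c, 0 <= c -> measurable_fun setT V -> (forall x, 0 <= V x) ->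
      (forall x, Om x -> V x <= c) -> (\int[pi0]_x (V x)%:E <= c%:E)%E].
Proof.
move=> muP mOm POm p0 pM.
pose rho (x : 'rV[R]_n) : R := p^-1 * \1_Om x.
have mrho : measurable_fun setT rho.
  by apply: measurable_funM => //; exact: measurable_indic.
have pV0 : 0 <= p^-1 by rewrite invr_ge0 ltW.
have rho0 x : 0 <= rho x by rewrite mulr_ge0// indicE.
have [m mE] := density_measure P mrho rho0.
have m1E (A : set 'rV[R]_n) : measurable A -> m A = (\int[P]_(x in A) (rho x)%:E)%E.
  move=> mA.
  have mA1 : measurable_fun setT (fun x : 'rV[R]_n => (\1_A x)%:E : \bar R).
    by apply/measurable_EFinP; exact: measurable_indic.
  transitivity (\int[m]_x (\1_A x)%:E)%E; first by rewrite integral_indic// setIT.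
  rewrite mE// (integral_mkcond A); apply: eq_integral => x _.
  by rewrite epatch_indic.
have intrho A : measurable A -> (\int[P]_(x in A) (rho x)%:E = p^-1%:E * P (Om `&` A))%E.
  move=> mA; under eq_integral do rewrite EFinM.
  rewrite ge0_integralZl_EFin// ?integral_indic//.
  by apply/measurable_funTS/measurable_EFinP; exact: measurable_indic.
have mOm1 : m Om = 1%E.
  by rewrite m1E// intrho// setIid POm -EFinM mulVf// gt_eqF.
have m1 : m setT = 1%E.
  by rewrite m1E// intrho// setIT POm -EFinM mulVf// gt_eqF.
have [pi0 pi0E] := probability_of_measure m1.
exists pi0; split.
- exists rho; split=> //; split=> [x|A mA].
    by rewrite rho0 (le_trans _ pM)// ler_piMr// indicE; case: (_ \in _).
  by rewrite pi0E m1E//; apply: eq_integral_on_measurable => B mB; rewrite muP.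
- by rewrite pi0E.
- move=> V c c0 mV V0 Vc.
  have mEV : measurable_fun setT (fun x => (V x)%:E) by exact/measurable_EFinP.
  have -> : (\int[pi0]_x (V x)%:E = \int[m]_x (V x)%:E)%E.
    by apply: eq_measure_integral => A _ _; exact: pi0E.
  rewrite mE//.
  apply: (@le_trans _ _ (\int[P]_x (c%:E * (rho x)%:E))%E).
    apply: ge0_le_integralT => x; first by rewrite -EFinM lee_fin mulr_ge0.
    rewrite -!EFinM lee_fin /rho indicE mulrC.
    have [Ox|_] := boolP (x \in Om); last by rewrite !mulr0.
    by rewrite ler_wpM2r ?mulr1//; apply: Vc; rewrite inE in Ox.
  have mErho : measurable_fun setT (fun x => (rho x)%:E) by exact/measurable_EFinP.
  rewrite ge0_integralZl_EFin//; last by move=> x _; rewrite lee_fin.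
  by have := m1E setT measurableT; rewrite m1 => <-; rewrite mule1.
Qed.

Lemma integral_expR_sqr (R : realType) (l : R) : 0 < l ->
  (\int[lebesgue_measure]_t (expR (- (l * t ^+ 2 / 2)))%:E = (Num.sqrt (2 * pi / l))%:E)%E.
Proof.
move=> l0.
pose s := (Num.sqrt l)^-1.
have sl0 : 0 < Num.sqrt l by rewrite sqrtr_gt0.
have s0 : s != 0 by rewrite invr_neq0// gt_eqF.
have s2 : s ^+ 2 = l^-1 by rewrite exprVn sqr_sqrtr// ltW.
have pk : (normal_peak s)^-1 = Num.sqrt (2 * pi / l).
  by rewrite /normal_peak invrK s2 -mulr_natl; congr Num.sqrt; ring.
transitivity (\int[lebesgue_measure]_t ((Num.sqrt (2 * pi / l))%:E * (normal_pdf 0 s t)%:E))%E.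
  apply: eq_integral => t _; rewrite -EFinM; congr (_%:E).
  rewrite normal_pdfE// -pk mulKf ?gt_eqF ?normal_peak_gt0//.
  rewrite /normal_fun s2; congr expR; field; exact: lt0r_neq0.
rewrite ge0_integralZl_EFin//= ?integral_normal_pdf ?mule1//.
- by move=> x _; rewrite lee_fin normal_pdf_ge0.
- by apply/measurable_EFinP; exact: measurable_normal_pdf.
Qed.

Lemma integral_expR_window (R : realType) (phi : R -> R) (w m : R) : 0 < w ->
  measurable_fun setT phi -> (forall t, 0 <= phi t) ->
  (forall t, - w <= t <= w -> phi t <= m) ->
  exists q, 2 * w * expR (- m) <= q <= 2 * w /\
    (\int[lebesgue_measure]_t (expR (- phi t) * \1_(`[- w, w]%classic : set R) t)%:E = q%:E)%E.
Proof.
move=> w0 mphi phi0 phim.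
set I := (\int[lebesgue_measure]_t _)%E.
have iw (k : R) : 0 <= k -> (\int[lebesgue_measure]_t (k * \1_(`[- w, w]%classic : set R) t)%:E = (2 * w * k)%:E)%E.
  move=> k0; under eq_integral do rewrite EFinM.
  have m1 : measurable_fun setT (fun t => (\1_(`[- w, w]%classic : set R) t)%:E : \bar R).
    by apply/measurable_EFinP; exact: measurable_indic.
  rewrite (ge0_integralZl_EFin lebesgue_measure)//.
  rewrite integral_indic//= setIT lebesgue_measure_itv/= lte_fin.
  rewrite gtrN// -EFinB -EFinM; congr (_%:E); ring.
have I1 : (I <= (2 * w)%:E)%E.
  rewrite -(mulr1 (2 * w)) -iw//; apply: ge0_le_integralT => t.
    by rewrite lee_fin mulr_ge0 ?expR_ge0// indicE.
  by rewrite lee_fin ler_wpM2r ?indicE// -[leRHS]expR0 ler_expR oppr_le0.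
have I2 : ((2 * w * expR (- m))%:E <= I)%E.
  rewrite -iw ?expR_ge0//; apply: ge0_le_integralT => t.
    by rewrite lee_fin mulr_ge0 ?expR_ge0// indicE.
  rewrite lee_fin indicE; case: (boolP (t \in _)); last by rewrite !mulr0.
  by rewrite inE/= in_itv/= !mulr1 => wt; rewrite ler_expR lerN2 phim.
have Ifin : I \is a fin_num.
  rewrite ge0_fin_numE; first by rewrite (le_lt_trans I1)// ltry.
  by apply: le_trans I2; rewrite lee_fin !mulr_ge0 ?expR_ge0// ltW.
exists (fine I); rewrite fineK//; split=> //.
by rewrite -!lee_fin fineK// I1 I2.
Qed.

(** The regimes all prove a total variation distance of at least [1/2], obtained as [3/4 - 1/4]. *)
Lemma expRN1_lt_half (R : realType) : expR (-1) < 2^-1 :> R.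
Proof.
rewrite expRN ltf_pV2 ?posrE ?expR_gt0//.
have := @expR_gt1Dx R 1 (oner_neq0 _).
by rewrite (_ : 1 + 1 = 2)//; ring.
Qed.

(** Bernoulli's inequality. *)
Lemma onem_exp_ge (R : realType) (e : R) n : 0 <= e <= 1 -> 1 - n%:R * e <= (1 - e) ^+ n.
Proof.
move=> /andP[e0 e1]; elim: n => [|n IH]; first by rewrite mul0r subr0 expr0.
rewrite exprS (le_trans _ (ler_wpM2l _ IH)) ?subr_ge0//.
have : 0 <= n%:R * e ^+ 2 by rewrite mulr_ge0// sqr_ge0.
rewrite -natr1; nra.
Qed.

Definition window (R : realType) n (w : 'I_n -> R) : set 'rV[R]_n :=
  [set x | forall i, x ord0 i \in `[- w i, w i]].

Lemma window_indic (R : realType) n (w : 'I_n -> R) (x : 'rV[R]_n) :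
  \1_(window w) x = (\prod_i \1_(`[- w i, w i]%classic : set R) (x ord0 i)) :> R.
Proof.
rewrite indicE; have [Bx|Bx] := pselect (window w x).
  by rewrite mem_set// big1// => i _; rewrite indicE mem_set//=; exact: Bx.
rewrite memNset//; move: Bx => /existsNP[i Bxi].
by rewrite (bigD1 i)//= indicE memNset ?mul0r.
Qed.

Lemma measurable_window (R : realType) n (w : 'I_n -> R) : measurable (window w).
Proof. by apply: (@measurable_box _ _ (fun i => `[- w i, w i]%classic)). Qed.

(** Common scheme for medium and large steps. The window has target mass between [exp(-n)], which
    gives the warmness, and [1/4]. From inside it a step is accepted with probability at most [eps],
    so while [T eps <= 1/4] the chain keeps mass [3/4] there. *)
Lemma mala_stuck (R : realType) n (lam : {measure set 'rV[R]_n -> \bar R})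
    (h k : R) (phi dphi ddphi : 'I_n -> R -> R) (Z w q C : 'I_n -> R) (eps : R) :
  is_lebesgue lam ->
  (forall i (t : R), is_derive t 1 (phi i) (dphi i t)) ->
  (forall i (t : R), is_derive t 1 (dphi i) (ddphi i t)) ->
  (forall i t, 1 <= ddphi i t <= k) ->
  (forall i, 0 < Z i) -> (forall i, 0 < q i) ->
  (forall i, \int[lebesgue_measure]_t (expR (- phi i t))%:E = (Z i)%:E)%E ->
  (forall i, \int[lebesgue_measure]_t
     (expR (- phi i t) * \1_(`[- w i, w i]%classic : set R) t)%:E = (q i)%:E)%E ->
  expR (- n%:R) <= \prod_i (q i / Z i) <= 4^-1 ->
  (forall i x, x \in `[- w i, w i] -> exists (b : R -> R) (c : R),
    [/\ measurable_fun setT b,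
      forall t, expR (log_accept1 h (phi i) (dphi i) x
                 (x - h * dphi i x + Num.sqrt (2 * h) * t)) <= b t,
      0 < c <= C i &
      (\int[lebesgue_measure]_t (normal_pdf 0 1 t * b t)%:E = c%:E)%E]) ->
  \prod_i C i <= eps -> 0 <= eps <= 1 ->
  exists (f : 'rV[R]_n -> R) (pi0 : probability 'rV[R]_n R),
    twice_differentiable f /\ hessian_bounded f k /\
    density_bounded (target lam f) pi0 (expR n%:R) /\
    forall T : nat, T%:R * eps <= 4^-1 ->
      ((expR (-1))%:E < tv_dist (mala_law lam h f pi0 T) (target lam f))%E.
Proof.
move=> hlam Hphi Hdphi Hdd Z0 q0 HZ Hq /andP[ple ple4] Hacc Ceps eps01.
have mphi i : measurable_fun setT (phi i) by exact: measurable_of_is_derive (Hphi i).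
have [P [PE PP]] := target_probability hlam mphi Z0 HZ.
have mW := measurable_window w.
set p := \prod_i _ in ple ple4.
have POm : P (window w) = p%:E.
  rewrite -(setIT (window w)) -integral_indic// /p -(PP (fun i => \1_(`[- w i, w i]%classic : set R)) q)//.
  by apply: eq_integral => x _; rewrite window_indic.
have p0 : 0 < p by apply: lt_le_trans ple; exact: expR_gt0.
have pM : p^-1 <= expR n%:R by rewrite -[leRHS]invrK -expRN lef_pV2 ?posrE ?expR_gt0.
have [pi0 [Hdens pi0W _]] := warm_start PE mW POm p0 pM.
exists (separable phi), pi0; split; first exact: twice_differentiable_separable Hphi Hdphi.
split; first exact: hessian_bounded_separable Hphi Hdphi Hdd.
split=> // T HT.
have stay : (((1 - eps) ^+ T)%:E <= mala_law lam h (separable phi) pi0 T (window w))%E.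
  apply: mala_law_stay => //.
  - exact: measurable_separable Hphi.
  - exact: measurable_grad_separable Hphi Hdphi.
  - move=> x Wx.
    (* The dominating functions depend on the current point; only their bounds [C i] are uniform on
       the window. *)
    have /choice[b /choice[c Hbc]] : forall i, exists (b : R -> R) (c : R),
      [/\ measurable_fun setT b,
      forall t, expR (log_accept1 h (phi i) (dphi i) (x ord0 i)
                 (x ord0 i - h * dphi i (x ord0 i) + Num.sqrt (2 * h) * t)) <= b t,
      0 < c <= C i &
      (\int[lebesgue_measure]_t (normal_pdf 0 1 t * b t)%:E = c%:E)%E].
      by move=> i; apply: Hacc; exact: Wx.
    apply: le_trans (integral_mala_accept_separable (b := b) (c := c) hlam Hphi _ _ _ _) _.
    + by move=> i; case: (Hbc i).
    + by move=> i; case: (Hbc i).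
    + by move=> i; case: (Hbc i) => _ _ /andP[].
    + by move=> i; case: (Hbc i).
    + rewrite lee_fin (le_trans _ Ceps)//; apply: ler_prod => i _.
      by case: (Hbc i) => _ _ /andP[c0 ->] _; rewrite ltW.
have tv := le_tv_dist (mala_law lam h (separable phi) pi0 T) (target lam (separable phi)) mW.
apply: lt_le_trans tv; rewrite PE// POm.
apply: (@lt_le_trans _ _ (2^-1)%:E); first by rewrite lte_fin; exact: expRN1_lt_half.
apply: le_trans (lee_abs _).
rewrite leeBrDr// -EFinD; apply: le_trans stay; rewrite lee_fin.
apply: le_trans (onem_exp_ge T eps01).
have -> : 2^-1 = 1 - 4^-1 - 4^-1 :> R by field.
lra.
Qed.

(** * One-dimensional acceptance bounds *)

Definition quad (R : realType) (l t : R) : R := l * t ^+ 2 / 2.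
Definition dquad (R : realType) (l t : R) : R := l * t.

Lemma is_derive_quad (R : realType) (l t : R) : is_derive t 1 (quad l) (dquad l t).
Proof.
rewrite /quad /dquad.
apply: is_derive_eq.
by rewrite /GRing.scale/=; field.
Qed.

Lemma is_derive_dquad (R : realType) (l t : R) : is_derive t 1 (dquad l) l.
Proof.
rewrite /dquad; apply: is_derive_eq.
by rewrite /GRing.scale/= mulr1.
Qed.

Lemma measurable_quad (R : realType) (l : R) : measurable_fun setT (quad l).
Proof. exact: measurable_of_is_derive (is_derive_quad l). Qed.

(** The trapezoidal rule is exact for quadratics, up to the symmetric form of its error here: only
    the gradient term survives. *)
Lemma log_accept1_quad (R : realType) (h l x y : R) : 0 < h ->
  log_accept1 h (quad l) (dquad l) x y = h * l ^+ 2 / 4 * (x ^+ 2 - y ^+ 2).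
Proof.
by move=> h0; rewrite /log_accept1 /quad /dquad; field; rewrite gt_eqF.
Qed.

(** In this form, [1 - v <= exp(-v)] gives numerical upper bounds [exp v <= 1 / (1 - v)] for
    [v < 1]. *)
Lemma expR_onem_le1 (R : realType) (v : R) : expR v * (1 - v) <= 1.
Proof.
rewrite -(@ler_pM2l _ (expR (- v))) ?expR_gt0// mulrA -expRD addNr expR0 mul1r mulr1.
exact: expR_ge1Dx.
Qed.

(* With [H = h l] the integral is explicit and equals the square root of
   [exp (v l x^2) (1 - v)] for [v = H^2 / (1 + H^2)]. *)
Lemma integral_accept_quad (R : realType) (h l x : R) : 0 < h -> 0 < l ->
  l * x ^+ 2 <= 2^-1 ->
  exists (b : R -> R) (c : R),
    [/\ measurable_fun setT b,
      forall t, expR (log_accept1 h (quad l) (dquad l) x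
                 (x - h * dquad l x + Num.sqrt (2 * h) * t)) <= b t,
      0 < c, c <= 1 /\ (1 <= h * l -> c <= 19 / 20) &
      (\int[lebesgue_measure]_t (normal_pdf 0 1 t * b t)%:E = c%:E)%E].
Proof.
move=> h0 l0 lx; have [H HE] : exists H, H = h * l by exists (h * l).
rewrite -HE.
have H0 : 0 < H by rewrite HE; exact: mulr_gt0.
pose s := h * l ^+ 2 / 4.
pose b t := expR (s * x ^+ 2) * expR (- s * ((1 - H) * x + Num.sqrt (2 * h) * t) ^+ 2).
have q : 1 + 2 * s * Num.sqrt (2 * h) ^+ 2 = 1 + H ^+ 2.
  by rewrite sqr_sqrtr ?mulr_ge0 ?ltW// /s HE; field.
have q0 : 0 < 1 + H ^+ 2 by rewrite ltr_wpDr// ?sqr_ge0.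
pose c := expR (s * x ^+ 2) * ((Num.sqrt (1 + H ^+ 2))^-1 *
  expR (- s * ((1 - H) * x) ^+ 2 / (1 + H ^+ 2))).
have mb2 : measurable_fun setT (fun t : R => expR (- s * ((1 - H) * x + Num.sqrt (2 * h) * t) ^+ 2)).
  apply: measurableT_comp => //; apply: measurable_funM => //.
  apply: measurable_funX; apply: measurable_funD => //; exact: measurable_funM.
have c0 : 0 < c by rewrite !mulr_gt0 ?expR_gt0// invr_gt0 sqrtr_gt0.
pose v := H ^+ 2 / (1 + H ^+ 2).
have v0 : 0 <= v by rewrite divr_ge0 ?sqr_ge0 ?ltW.
have v1 : v <= 1 by rewrite /v ler_pdivrMr// mul1r lerDr.
have vE : (1 + H ^+ 2)^-1 = 1 - v by rewrite /v; field; rewrite gt_eqF.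
have c2 : c ^+ 2 <= expR (v / 2) * (1 - v).
  rewrite /c exprMn (exprMn 2 (_^-1)) exprVn sqr_sqrtr ?(ltW q0)// vE mulrCA [X in X <= _]mulrC ler_wpM2r ?subr_ge0//.
  rewrite -!expRM_natl -expRD ler_expR.
  have -> : 2%:R * (s * x ^+ 2) + 2%:R * (- s * ((1 - H) * x) ^+ 2 * (1 - v)) =
     v * (l * x ^+ 2).
    by rewrite -vE /s /v HE; field; rewrite -HE gt_eqF.
  by rewrite ler_wpM2l.
exists b, c; split=> //.
- exact: measurable_funM.
- move=> t; rewrite log_accept1_quad// /b -expRD ler_expR /dquad.
  by rewrite le_eqVlt; apply/orP; left; apply/eqP; rewrite /s HE; ring.
- split=> [|H1].
    (* Here [c^2 <= exp(v / 2) (1 - v) <= exp v (1 - v) <= 1]. *)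
    rewrite -(@ler_pXn2r _ 2)// ?nnegrE ?ler01 ?(ltW c0)// expr1n (le_trans c2)//.
    apply: le_trans (expR_onem_le1 v); rewrite ler_wpM2r ?subr_ge0// ler_expR.
    by rewrite ler_pdivrMr// ler_peMr// ler1n.
  rewrite -(@ler_pXn2r _ 2)// ?nnegrE ?(ltW c0)//.
  rewrite (le_trans c2)//.
  (* For [H >= 1] one has [1/2 <= v <= 1], hence [c^2 <= 16/9 * 1/2 = 8/9], below [(19/20)^2]. *)
  have v2 : 2^-1 <= v.
    by rewrite /v ler_pdivlMr//; have : 1 <= H ^+ 2 by [exact: exprn_ege1]; lra.
  have e14 : expR (4^-1) <= 4 / 3 :> R by have := expR_onem_le1 (4^-1 : R); lra.
  have e12 : expR (v / 2) <= 16 / 9.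
    rewrite (@le_trans _ _ (expR (4^-1) ^+ 2))//.
      by rewrite -expRM_natl ler_expR; lra.
    have : 0 <= expR (4^-1) :> R by exact: expR_ge0.
    nra.
  have := expR_ge0 (v / 2); nra.
- under eq_integral do rewrite /b mulrCA EFinM.
  rewrite ge0_integralZl_EFin ?expR_ge0//.
  + by rewrite integral_normal_pdf_expR_sqr q.
  + by move=> t _; rewrite lee_fin mulr_ge0 ?normal_pdf_ge0 ?expR_ge0.
  + by apply/measurable_EFinP; apply: measurable_funM => //; exact: measurable_normal_pdf.
Qed.

(* [b h / 2 * (t^2 / (h + t^2))] bends the quadratic on the length scale
   [sqrt h] of one proposal; its trapezoidal error is nonpositive from [0]. *)
Definition hard (R : realType) (a b h t : R) : R :=
  a * t ^+ 2 / 2 + b * h / 2 * (t ^+ 2 / (h + t ^+ 2)).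
Definition dhard (R : realType) (a b h t : R) : R :=
  a * t + b * h ^+ 2 * t / (h + t ^+ 2) ^+ 2.
Definition ddhard (R : realType) (a b h t : R) : R :=
  a + b * h ^+ 2 * (h - 3 * t ^+ 2) / (h + t ^+ 2) ^+ 3.

Lemma is_derive_inv (R : realType) (f : R -> R) (t df : R) :
  f t != 0 -> is_derive t 1 f df ->
  is_derive t 1 (fun s => (f s)^-1) (- (f t) ^- 2 * df).
Proof.
move=> ft Hf; apply: DeriveDef; first by apply: derivableV => //; exact: ex_derive.
by rewrite deriveV ?derive_val//.
Qed.

Lemma is_derive_hard (R : realType) (a b h t : R) : 0 < h ->
  is_derive t 1 (hard a b h) (dhard a b h t).
Proof.
move=> h0; have ht : h + t ^+ 2 != 0 by rewrite gt_eqF// ltr_pwDl// sqr_ge0.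
have Hq : is_derive t 1 (fun t => h + t ^+ 2) (2 * t).
  by apply: is_derive_eq; rewrite /GRing.scale/=; ring.
have Hi := @is_derive_inv R (fun t => h + t ^+ 2) t _ ht Hq.
rewrite /hard /dhard; apply: is_derive_eq.
by rewrite /GRing.scale/=; field.
Qed.

Lemma is_derive_dhard (R : realType) (a b h t : R) : 0 < h ->
  is_derive t 1 (dhard a b h) (ddhard a b h t).
Proof.
move=> h0; have ht : h + t ^+ 2 != 0 by rewrite gt_eqF// ltr_pwDl// sqr_ge0.
have Hq : is_derive t 1 (fun t => (h + t ^+ 2) ^+ 2) (4 * t * (h + t ^+ 2)).
  by apply: is_derive_eq; rewrite /GRing.scale/=; ring.
have Hi := @is_derive_inv R (fun t => (h + t ^+ 2) ^+ 2) t _ (expf_neq0 2 ht) Hq.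
rewrite /dhard /ddhard; apply: is_derive_eq.
by rewrite /GRing.scale/=; field.
Qed.

(** Expanding [(h + t^2)^3] shows that it dominates both [h^3] and [3 h^2 t^2]. With [a = k / 2] and
    [b = k / 4] the curvature lies in [[k / 4, 3 k / 4]], inside [[1, k]] when [k >= 10]. *)
Lemma ddhard_bounds (R : realType) (a b h t : R) : 0 < h -> 0 <= b ->
  a - b <= ddhard a b h t <= a + b.
Proof.
move=> h0 b0; rewrite /ddhard.
set v := (h + t ^+ 2).
have v0 : 0 < v by rewrite ltr_pwDl// sqr_ge0.
have t0 : 0 <= t ^+ 2 by exact: sqr_ge0.
suff : - 1 <= h ^+ 2 * (h - 3 * t ^+ 2) / v ^+ 3 <= 1.
  by rewrite -!(mulrA b); set q := (_ / _); move=> /andP[? ?]; apply/andP; split; nra.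
rewrite ler_pdivlMr ?exprn_gt0// ler_pdivrMr ?exprn_gt0// mulN1r mul1r.
rewrite /v; move: t0; set w := t ^+ 2 => w0.
have e0 : 0 <= h ^+ 3 by rewrite exprn_ge0// ltW.
have e1 : 0 <= h ^+ 2 * w by rewrite mulr_ge0// sqr_ge0.
have e2 : 0 <= h * w ^+ 2 by rewrite mulr_ge0 ?sqr_ge0// ltW.
have e3 : 0 <= w ^+ 3 by rewrite exprn_ge0.
have -> : (h + w) ^+ 3 = h ^+ 3 + 3 * (h ^+ 2 * w) + 3 * (h * w ^+ 2) + w ^+ 3 by ring.
have -> : h ^+ 2 * (h - 3 * w) = h ^+ 3 - 3 * (h ^+ 2 * w) by ring.
by apply/andP; split; lra.
Qed.

(* The left-hand side is the log-acceptance ratio in units of [sqrt h], for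
   [A = h a] and [B = h b].  The term [- (A y + B p y)^2 / 4] absorbs the cross
   term [B y p(x) / 2], the only unbounded error made by replacing [x] by [0]. *)
Lemma hard_algebra (R : realType) (x y A B r : R) :
  let P t := t ^+ 2 / (1 + t ^+ 2) / 2 in
  let p t := t / (1 + t ^+ 2) ^+ 2 in
  - r <= x <= r -> r <= 1 -> 0 < B -> B <= 4^-1 -> A = 2 * B ->
  B * (P x - P y + (y - x) * (p x + p y) / 2) + (A * x + B * p x) ^+ 2 / 4
    - (A * y + B * p y) ^+ 2 / 4 <=
  r - B * (y ^+ 4 / (1 + y ^+ 2) ^+ 2 / 2).
Proof.
move=> P p /andP[x1 x2] r1 B0 B4 AB.
have r0 : 0 <= r by lra.
have pos (t : R) : 0 < 1 + t ^+ 2 by rewrite ltr_pwDl// sqr_ge0.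
have [u [uE u0 u1]] : exists u, [/\ u = (1 + x ^+ 2)^-1, 0 < u & u <= 1].
  by exists (1 + x ^+ 2)^-1; rewrite invr_gt0 pos invf_le1// lerDl sqr_ge0.
have [v [vE v0 v1]] : exists v, [/\ v = (1 + y ^+ 2)^-1, 0 < v & v <= 1].
  by exists (1 + y ^+ 2)^-1; rewrite invr_gt0 pos invf_le1// lerDl sqr_ge0.
have Px : P x = x ^+ 2 * u / 2 by rewrite uE.
have px : p x = x * u ^+ 2 by rewrite uE exprVn.
have py : p y = y * v ^+ 2 by rewrite vE exprVn.
(* The opposite of this quantity is the trapezoidal error of [P] from [0] to [y]; it is the gain to
   be kept. *)
have psi : y ^+ 4 / (1 + y ^+ 2) ^+ 2 / 2 = P y - y * p y / 2.
  by rewrite /P /p; field; rewrite gt_eqF.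
rewrite psi.
have yv : `|y * v ^+ 2| <= 1.
  rewrite normrM (ger0_norm (sqr_ge0 v)).
  have : `|y| * v <= 1.
    rewrite vE ler_pdivrMr// mul1r -(real_normK (num_real y)).
    by have := sqr_ge0 (`|y| - 1); nra.
  by move=> h; have := normr_ge0 y; nra.
have x2r : x ^+ 2 <= r ^+ 2 by nra.
have u2 : 0 <= u ^+ 2 <= 1 by apply/andP; split; [exact: sqr_ge0|nra].
have e1 : P x <= r / 2 by rewrite Px; have := sqr_ge0 x; nra.
have e2 : 0 <= x * p x by rewrite px mulrA -expr2 mulr_ge0 ?sqr_ge0.
have xr : `|x| <= r by rewrite ler_norml x1 x2.
have e3 : - (x * p y) <= r.
  rewrite py; apply: le_trans (ler_norm _) _; rewrite normrN normrM.
  by have := normr_ge0 x; have := normr_ge0 (y * v ^+ 2); nra.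
have e4 : y * p x <= `|y| * r.
  rewrite px; apply: le_trans (ler_norm _) _; rewrite normrM ler_wpM2l//.
  rewrite normrM (ger0_norm (sqr_ge0 u)); case/andP: u2 => u20 u21.
  by have := normr_ge0 x; nra.
have e5 : (A * x + B * p x) ^+ 2 <= r.
  rewrite px (_ : A * x + B * (x * u ^+ 2) = x * (A + B * u ^+ 2)); last by ring.
  rewrite exprMn; case/andP: u2 => u20 u21.
  have : (A + B * u ^+ 2) ^+ 2 <= 1 by rewrite AB; nra.
  have := sqr_ge0 (A + B * u ^+ 2); have := sqr_ge0 x; nra.
have e6 : A ^+ 2 * `|y| ^+ 2 <= (A * y + B * p y) ^+ 2.
  rewrite real_normK ?num_real// py.
  rewrite (_ : A * y + B * (y * v ^+ 2) = y * (A + B * v ^+ 2)); last by ring.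
  rewrite exprMn mulrC ler_wpM2l ?sqr_ge0//.
  by rewrite ler_pXn2r// ?nnegrE ?addr_ge0 ?mulr_ge0 ?sqr_ge0 ?AB//; nra.
set Y := `|y| in e4 e6.
have Y0 : 0 <= Y by exact: normr_ge0.
(* Arithmetic-geometric mean inequality. Since [A = 2 B], the term [A^2 Y^2 / 4] is exactly
   [B^2 Y^2]. *)
have e7 : B * (Y * r) / 2 <= A ^+ 2 * Y ^+ 2 / 4 + r ^+ 2 / 16.
  by rewrite AB; have := sqr_ge0 (4 * B * Y - r); nra.
have e8 : r ^+ 2 <= r by nra.
(* The error from [0] is separated from the four terms involving [x]; these and the gradient terms
   cost at most [r] in total. *)
have -> : B * (P x - P y + (y - x) * (p x + p y) / 2) =
  B * P x - B * (P y - y * p y / 2) + B * (y * p x) / 2 - B * (x * p x) / 2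
   + B * (- (x * p y)) / 2 by ring.
have f1 : B * P x <= r / 8 by nra.
have f2 : B * (y * p x) <= B * (Y * r) by rewrite ler_wpM2l// ltW.
have f3 : 0 <= B * (x * p x) by rewrite mulr_ge0// ltW.
have f4 : B * (- (x * p y)) <= r / 4 by nra.
lra.
Qed.

(** Measuring lengths in units of [s], the square root of the step size, makes the step size one; it
    survives only in the dimensionless [A] and [B]. Here [p] is the derivative of [P]. *)
Lemma log_accept1_hard (R : realType) (a b s x y : R) : 0 < s ->
  let A := s ^+ 2 * a in let B := s ^+ 2 * b in
  let P t := t ^+ 2 / (1 + t ^+ 2) / 2 in
  let p t := t / (1 + t ^+ 2) ^+ 2 in
  log_accept1 (s ^+ 2) (hard a b (s ^+ 2)) (dhard a b (s ^+ 2)) (s * x) (s * y) =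
  B * (P x - P y + (y - x) * (p x + p y) / 2) + (A * x + B * p x) ^+ 2 / 4
    - (A * y + B * p y) ^+ 2 / 4.
Proof.
move=> s0 A B P p.
have pos (t : R) : 1 + t ^+ 2 != 0 by rewrite gt_eqF// ltr_pwDl// sqr_ge0.
have sn : s != 0 by rewrite gt_eqF.
have den t : s ^+ 2 + (s * t) ^+ 2 = s ^+ 2 * (1 + t ^+ 2) by ring.
have E1 t : hard a b (s ^+ 2) (s * t) = A * t ^+ 2 / 2 + B * P t.
  by rewrite /hard den /P /A /B; field; rewrite sn pos.
have E2 t : dhard a b (s ^+ 2) (s * t) = s^-1 * (A * t + B * p t).
  by rewrite /dhard den /p /A /B; field; rewrite sn pos.
rewrite /log_accept1 !E1 !E2; move: (P x) (P y) (p x) (p y) => Px Py px py.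
by field.
Qed.

(** On [[1, 2]] the standard normal density is at least [1/3 * 1/16], because [2 pi <= 9] and
    [exp(-2) >= 2^(-4)]. *)
Lemma integral_normal_12 (R : realType) : exists N : R, 48^-1 <= N <= 1 /\
  (\int[lebesgue_measure]_t (normal_pdf 0 1 t * \1_(`[1, 2]%classic : set R) t)%:E = N%:E)%E.
Proof.
set I := (\int[lebesgue_measure]_t _)%E.
have I1 : (I <= 1)%E.
  rewrite -(integral_normal_pdf (0 : R) 1); apply: ge0_le_integralT => t.
    by rewrite lee_fin mulr_ge0 ?normal_pdf_ge0// indicE.
  by rewrite lee_fin ler_piMr ?normal_pdf_ge0// indicE; case: (_ \in _).
have I2 : ((48^-1)%:E <= I)%E.
  have -> : ((48^-1)%:E = \int[lebesgue_measure]_t ((48^-1)%:E * (\1_(`[1, 2]%classic : set R) t)%:E) :> \bar R)%E.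
    have m1 : measurable_fun setT (fun t => (\1_(`[1, 2]%classic : set R) t)%:E : \bar R).
      by apply/measurable_EFinP; exact: measurable_indic.
    rewrite (ge0_integralZl_EFin lebesgue_measure)//.
    rewrite integral_indic//= setIT lebesgue_measure_itv/= lte_fin ltr1n -EFinB.
    by rewrite (_ : 2 - 1 = 1) ?mule1//; ring.
  apply: ge0_le_integralT => t.
    by rewrite -EFinM lee_fin mulr_ge0// indicE.
  rewrite -EFinM lee_fin indicE; case: (boolP (t \in _)); last by rewrite !mulr0.
  rewrite inE/= in_itv/= !mulr1 => /andP[t1 t2].
  rewrite normal_pdfE ?oner_neq0// /normal_peak /normal_fun subr0 expr1n mul1r.
  have e4 : (2^-1 : R) <= expR (- 2^-1).
    by have := expR_ge1Dx (- 2^-1 : R); lra.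
  have e2 : (16^-1 : R) <= expR (- t ^+ 2 / 2%:R).
    have -> : (16^-1 : R) = 2^-1 ^+ 4 by rewrite !exprS expr0; field.
    apply: (@le_trans _ _ (expR (- 2^-1) ^+ 4)).
      by rewrite ler_pXn2r// ?nnegrE ?expR_ge0.
    rewrite -expRM_natl ler_expR; nra.
  have pi0 : 0 < pi *+ 2 :> R by rewrite pmulrn_lgt0// pi_gt0.
  have pi9 : pi *+ 2 <= 9 :> R.
    by have := @pihalf_lt2 R; rewrite -mulr_natl ltr_pdivrMr// => ?; lra.
  have p3 : (3^-1 : R) <= (Num.sqrt (pi *+ 2))^-1.
    rewrite lef_pV2 ?posrE ?sqrtr_gt0//.
    rewrite -(@ler_pXn2r _ 2)// ?nnegrE ?sqrtr_ge0// sqr_sqrtr ?(ltW pi0)//.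
    by apply: le_trans pi9 _; rewrite expr2; lra.
  apply: (@le_trans _ _ (3^-1 * 16^-1)); first by lra.
  by apply: ler_pM.
have Ifin : I \is a fin_num.
  rewrite ge0_fin_numE; first by rewrite (le_lt_trans I1)// ltry.
  by apply: le_trans I2; rewrite lee_fin.
by exists (fine I); rewrite fineK//; split=> //; rewrite -!lee_fin fineK// I1 I2.
Qed.

(** The ratio is at most [exp r] for every noise value, and at most [exp(r - B / 8)] for noise in
    [[1, 2]]. The constant [64 * 96] is chosen so that the mean gain, at least [B / 16 * 1/48],
    equals [2 r]; this leaves [exp r exp(-2 r)]. *)
Lemma integral_accept_hard (R : realType) (h k x : R) : 0 < h -> 0 < k -> h * k <= 1 ->
  let r := h * k / (64 * 96) in
  - (r * Num.sqrt h) <= x <= r * Num.sqrt h ->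
  exists (b : R -> R) (c : R),
    [/\ measurable_fun setT b,
      forall t, expR (log_accept1 h (hard (k / 2) (k / 4) h) (dhard (k / 2) (k / 4) h) x
                 (x - h * dhard (k / 2) (k / 4) h x + Num.sqrt (2 * h) * t)) <= b t,
      0 < c <= expR (- r) &
      (\int[lebesgue_measure]_t (normal_pdf 0 1 t * b t)%:E = c%:E)%E].
Proof.
move=> h0 k0 hk1 r; set s := Num.sqrt h => xr.
have s0 : 0 < s by rewrite sqrtr_gt0.
have sn : s != 0 by rewrite gt_eqF.
have s2 : s ^+ 2 = h by rewrite sqr_sqrtr// ltW.
have hk0 : 0 < h * k by exact: mulr_gt0.
have r0 : 0 < r by rewrite /r; lra.
have rle : r <= 4^-1 by rewrite /r; lra.
pose B := h * (k / 4); pose A := h * (k / 2).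
have B0 : 0 < B by rewrite mulr_gt0// divr_gt0.
have B4 : B <= 4^-1 by rewrite /B; lra.
have AB : A = 2 * B by rewrite /A /B; field.
(* [z] is the relative saving when the noise falls in [[1, 2]]. *)
pose z := 1 - expR (- (B / 8)).
have z0 : B / 16 <= z.
  have : expR (- (B / 8)) * (1 + B / 8) <= 1.
    by have := expR_onem_le1 (- (B / 8)); rewrite opprK.
  rewrite /z; have := expR_ge0 (- (B / 8)); nra.
have z1 : z < 1 by rewrite /z ltrBlDr ltrDl expR_gt0.
have [N [/andP[N48 N1] HN]] := integral_normal_12 R.
pose I := (`[1, 2]%classic : set R).
pose b t := expR r * (1 - z * \1_I t).
have mI : measurable_fun setT (\1_I : R -> R) by apply: measurable_indic; exact: measurable_itv.
have mb : measurable_fun setT (fun t => 1 - z * \1_I t).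
  by apply: measurable_funB => //; exact: measurable_funM.
have zI t : 0 <= 1 - z * \1_I t.
  by rewrite indicE; case: (_ \in _); rewrite ?mulr1 ?mulr0 ?subr0// subr_ge0 ltW.
have zge0 : 0 <= z by apply: le_trans z0; rewrite divr_ge0// ltW.
exists b, (expR r * (1 - z * N)); split.
- exact: measurable_funM.
- move=> t.
  pose X := x / s; pose Y := (x - h * dhard (k / 2) (k / 4) h x + Num.sqrt (2 * h) * t) / s.
  have xX : x = s * X by rewrite /X; field.
  have -> : x - h * dhard (k / 2) (k / 4) h x + Num.sqrt (2 * h) * t = s * Y.
    by rewrite /Y; field.
  have X1 : - r <= X <= r.
    by rewrite /X ler_pdivlMr// ler_pdivrMr// mulNr.
  have HA := @hard_algebra R X Y A B r X1 _ B0 B4 AB.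
  rewrite xX -{1 2 3}s2 log_accept1_hard// s2 -/A -/B.
  apply: (@le_trans _ _ (expR (r - B * (Y ^+ 4 / (1 + Y ^+ 2) ^+ 2 / 2)))).
    by rewrite ler_expR; apply: HA; lra.
  rewrite expRD /b ler_wpM2l ?expR_ge0// indicE.
  have Y4 : 0 <= Y ^+ 4 / (1 + Y ^+ 2) ^+ 2 / 2.
    rewrite divr_ge0// divr_ge0 ?sqr_ge0//.
    by rewrite (_ : Y ^+ 4 = (Y ^+ 2) ^+ 2) ?sqr_ge0//; ring.
  case: (boolP (t \in I)) => [|_]; last first.
    by rewrite mulr0 subr0 -[leRHS]expR0 ler_expR oppr_le0 mulr_ge0// ltW.
  rewrite inE /I/= in_itv/= => /andP[t1 t2].
  rewrite mulr1 (_ : 1 - z = expR (- (B / 8))); last by rewrite /z; ring.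
  rewrite ler_expR lerN2 ler_wpM2l ?(ltW B0)//.
  (* The drift multiplies [X] by a factor in [[1/4, 1]], so it contributes at least [-r >= -1/4],
     while the noise contributes at least [5/4]. *)
  have Y1 : 1 <= Y.
    have YE : Y = X * (1 - A - B / (1 + X ^+ 2) ^+ 2) + Num.sqrt 2 * t.
      rewrite /Y sqrtrM// -/s /dhard -s2 xX /A /B -s2.
      have Xn : 1 + X ^+ 2 != 0 by rewrite gt_eqF// ltr_pwDl// sqr_ge0.
      have -> : s ^+ 2 + (s * X) ^+ 2 = s ^+ 2 * (1 + X ^+ 2) by ring.
      by field; rewrite sn Xn.
    have sq2 : 5 / 4 <= Num.sqrt 2 :> R.
      by rewrite -(@ler_pXn2r _ 2)// ?nnegrE ?sqrtr_ge0// sqr_sqrtr//; lra.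
    have [g [gE g0 g1]] : exists g, [/\ g = B / (1 + X ^+ 2) ^+ 2, 0 <= g & g <= B].
      exists (B / (1 + X ^+ 2) ^+ 2); split=> //.
        by rewrite divr_ge0 ?sqr_ge0// ltW.
      by rewrite ler_pdivrMr ?exprn_gt0 ?ltr_pwDl ?sqr_ge0// ler_peMr ?(ltW B0)// exprn_ege1// lerDl sqr_ge0.
    rewrite YE -gE; case/andP: X1 => X1 X2.
    have : - r <= X * (1 - A - g) by nra.
    have : 5 / 4 <= Num.sqrt 2 * t by nra.
    lra.
  have Y2 : 1 <= Y ^+ 2 by rewrite exprn_ege1.
  rewrite (_ : Y ^+ 4 = (Y ^+ 2) ^+ 2); last by ring.
  rewrite ler_pdivlMr// ler_pdivlMr ?exprn_gt0 ?ltr_pwDl ?sqr_ge0//; nra.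
- apply/andP; split.
    rewrite mulr_gt0 ?expR_gt0// subr_gt0; nra.
  apply: (@le_trans _ _ (expR r * expR (- (2 * r)))).
    rewrite ler_wpM2l ?expR_ge0//.
    have := expR_ge1Dx (- (2 * r)).
    suff : 2 * r <= z * N by lra.
    have -> : r = B / (16 * 96) by rewrite /r /B; field.
    nra.
  by rewrite -expRD ler_expR; lra.
- under eq_integral do rewrite /b mulrCA EFinM.
  have mn : measurable_fun setT (normal_pdf (0 : R) 1) by exact: measurable_normal_pdf.
  have n0 t : 0 <= normal_pdf (0 : R) 1 t by exact: normal_pdf_ge0.
  rewrite ge0_integralZl_EFin ?expR_ge0//; last 2 first.
  + by move=> t _; rewrite lee_fin mulr_ge0.
  + by apply/measurable_EFinP; exact: measurable_funM.
  rewrite EFinM; congr (_ * _)%E.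
  set J := (\int[lebesgue_measure]_t _)%E.
  (* [J] is found by adding back the removed mass, which restores the total mass one of the normal
     density. *)
  have : (J + (z * N)%:E = 1)%E.
    rewrite EFinM -HN -ge0_integralZl_EFin//; last 2 first.
    * by move=> t _; rewrite lee_fin mulr_ge0// indicE.
    * by apply/measurable_EFinP; exact: measurable_funM.
    rewrite /J -ge0_integralD//; last 4 first.
    * by move=> t _; rewrite lee_fin mulr_ge0.
    * by apply/measurable_EFinP; exact: measurable_funM.
    * by move=> t _; rewrite -EFinM lee_fin !mulr_ge0// indicE.
    * under eq_fun do rewrite -EFinM.
      by apply/measurable_EFinP; apply: measurable_funM => //; exact: measurable_funM.
    rewrite -(integral_normal_pdf (0 : R) 1); apply: eq_integral => t _.
    rewrite -EFinM -EFinD; congr (_%:E); rewrite -/I; ring.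
  move=> /(congr1 (fun u => u - (z * N)%:E)%E).
  by rewrite addeK// EFinB.
Qed.

(** * The three regimes of the step size *)

(** One link in a chain of repeated squarings that bounds an exponential below by rationals. *)
Lemma expr2_ge (R : realType) (a b e : R) : a <= e -> 0 <= a -> b <= a ^+ 2 -> b <= e ^+ 2.
Proof. by move=> ae a0 /le_trans; apply; apply: lerXn2r; rewrite ?nnegrE// (le_trans a0). Qed.

Lemma quad_window (R : realType) (l t : R) : 0 < l ->
  (- Num.sqrt (2 * l)^-1 <= t <= Num.sqrt (2 * l)^-1) -> l * t ^+ 2 <= 2^-1.
Proof.
move=> l0 tw; have l2 : 0 < 2 * l by rewrite mulr_gt0.
have : t ^+ 2 <= (2 * l)^-1.
  rewrite -[leRHS]sqr_sqrtr ?invr_ge0 ?(ltW l2)//.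
  by rewrite -(real_normK (num_real t)) ler_pXn2r// ?nnegrE ?sqrtr_ge0// ler_norml.
rewrite invfM => h; apply: (@le_trans _ _ (l * (2^-1 * l^-1))).
  by rewrite ler_wpM2l// ltW.
by rewrite mulrCA mulfV ?mulr1// gt_eqF.
Qed.

(** Since [Z = sqrt pi * 2 w], the ratio [q / Z] lies between [exp(-1/4) / sqrt pi] and
    [1 / sqrt pi], whatever [l] is. The bound [exp(-49/50)] stays above the budget [exp(-1)] per
    coordinate; the spare [1/50] later pays for the bent coordinates. *)
Lemma quad_window_mass (R : realType) (l : R) : 0 < l ->
  let w := Num.sqrt (2 * l)^-1 in let Z := Num.sqrt (2 * pi / l) in
  exists q, [/\ 0 < q,
    (\int[lebesgue_measure]_t (expR (- quad l t) * \1_(`[- w, w]%classic : set R) t)%:E = q%:E)%E,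
    expR (- (49 / 50)) <= q / Z & q / Z <= 3 / 4].
Proof.
move=> l0 w Z; have l2 : 0 < 2 * l by rewrite mulr_gt0.
have w0 : 0 < w by rewrite sqrtr_gt0 invr_gt0.
have Z0 : 0 < Z by rewrite sqrtr_gt0 divr_gt0// mulr_gt0// pi_gt0.
have Zw : Z = Num.sqrt pi * (2 * w).
  rewrite -[2 in RHS]ger0_norm// -sqrtr_sqr /w -!sqrtrM ?sqr_ge0 ?pi_ge0//.
  by congr Num.sqrt; field; rewrite gt_eqF.
have sp0 : 0 < Num.sqrt pi :> R by rewrite sqrtr_gt0 pi_gt0.
have sp2 : Num.sqrt pi <= 2 :> R.
  rewrite -(@ler_pXn2r _ 2)// ?nnegrE ?sqrtr_ge0// sqr_sqrtr ?pi_ge0//.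
  by have := @pihalf_lt2 R; rewrite ltr_pdivrMr// => ?; rewrite expr2; lra.
have sp1 : 4 / 3 <= Num.sqrt pi :> R.
  rewrite -(@ler_pXn2r _ 2)// ?nnegrE ?sqrtr_ge0 ?divr_ge0// sqr_sqrtr ?pi_ge0//.
  by have := @pi_ge2 R => ?; rewrite expr2; lra.
have [q [/andP[q1 q2] Hq]] : exists q, 2 * w * expR (- 4^-1) <= q <= 2 * w /\
    (\int[lebesgue_measure]_t (expR (- quad l t) * \1_(`[- w, w]%classic : set R) t)%:E = q%:E)%E.
  apply: integral_expR_window => //; first exact: measurable_quad.
    by move=> t; rewrite /quad divr_ge0// mulr_ge0 ?sqr_ge0// ltW.
  by move=> t /(quad_window l0); rewrite /quad => ?; lra.
have q0 : 0 < q by apply: lt_le_trans q1; rewrite !mulr_gt0 ?expR_gt0.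
exists q; split=> //.
  rewrite ler_pdivlMr// Zw.
  apply: le_trans q1.
  rewrite (_ : expR _ * _ = 2 * w * (expR (- (49 / 50)) * Num.sqrt pi)); last by ring.
  rewrite ler_wpM2l ?mulr_ge0 ?(ltW w0)//.
  (* [73/100 = 49/50 - 1/4] is the room left for [sqrt pi <= 2]. *)
  have e1 : 2 <= expR (73 / 100) :> R.
    have -> : expR (73 / 100) = ((expR (73 / 800) ^+ 2) ^+ 2) ^+ 2 :> R.
      by rewrite -!exprM -expRM_natl; congr expR; field.
    apply: (@expr2_ge _ (17 / 12)); [|lra|lra].
    apply: (@expr2_ge _ (25 / 21)); [|lra|lra].
    apply: (@expr2_ge _ (1 + 73 / 800)); [exact: expR_ge1Dx|lra|lra].
  have -> : - 4^-1 = - (49 / 50) + 73 / 100 :> R by field.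
  rewrite expRD ler_wpM2l ?expR_ge0//.
  by apply: le_trans e1.
rewrite ler_pdivrMr// Zw (le_trans q2)//.
by nra.
Qed.

(** Once the rejection is bounded away, the mean of [exp(sqnorm y / 8)] over the proposal is an
    explicit Gaussian integral; each coordinate contributes at most [exp(h / 2)] times its old
    value. *)
Lemma integral_drift_quad (R : realType) n (lam : {measure set 'rV[R]_n -> \bar R}) h (x : 'rV[R]_n)
    (f : 'rV[R]_n -> R) :
  is_lebesgue lam -> 0 < h <= 1 -> f = separable (fun=> quad 1) ->
  (\int[lam]_g (gauss_density g *
     (mala_accept h f x (mala_prop h f x g) * expR (sqnorm (mala_prop h f x g) / 8) +
      (1 - mala_accept h f x (mala_prop h f x g)) * expR (sqnorm x / 8)))%:E <=
   (expR (h * n%:R / 2) * expR (sqnorm x / 8))%:E)%E.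
Proof.
move=> hlam /andP[h0 h1] fE.
have Hphi (i : 'I_n) (t : R) : is_derive t 1 (quad 1) (dquad 1 t) by exact: is_derive_quad.
pose y i t := (1 - h) * x ord0 i + Num.sqrt (2 * h) * t.
have yE g i : mala_prop h f x g ord0 i = y i (g ord0 i).
  by rewrite fE (mala_prop_separable _ _ _ _ Hphi) /y /dquad; ring.
(* If [y] is farther out than [x], the left side is a convex combination bounded by its larger
   value; otherwise the acceptance probability is one. *)
have step g : mala_accept h f x (mala_prop h f x g) * expR (sqnorm (mala_prop h f x g) / 8) +
      (1 - mala_accept h f x (mala_prop h f x g)) * expR (sqnorm x / 8) <=
      expR (sqnorm (mala_prop h f x g) / 8).
  set Y := mala_prop h f x g.
  have aE : mala_accept h f x Y = Num.min 1 (expR (h / 4 * (sqnorm x - sqnorm Y))).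
    rewrite fE (mala_accept_separable _ _ _ Hphi); congr (Num.min 1 (expR _)).
    rewrite /sqnorm -sumrB mulr_sumr; apply: eq_bigr => i _.
    by rewrite log_accept1_quad// expr1n mulr1.
  have [xY|Yx] := leP (sqnorm x) (sqnorm Y).
    have : expR (sqnorm x / 8) <= expR (sqnorm Y / 8) by rewrite ler_expR ler_wpM2r.
    by have /andP[a0 a1] := mala_accept_01 h f x Y; nra.
  have -> : mala_accept h f x Y = 1.
    rewrite aE; apply/min_idPl; rewrite -[leLHS]expR0 ler_expR.
    by rewrite mulr_ge0 ?divr_ge0 ?subr_ge0 ?ltW.
  by rewrite subrr mul0r addr0 mul1r.
have q0 : 0 < 1 + 2 * - 8^-1 * Num.sqrt (2 * h) ^+ 2.
  by rewrite sqr_sqrtr ?mulr_ge0 ?(ltW h0)//; lra.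
pose b i t := expR (- (- 8^-1) * (y i t) ^+ 2).
pose c i := (Num.sqrt (1 + 2 * - 8^-1 * Num.sqrt (2 * h) ^+ 2))^-1 *
  expR (- - 8^-1 * ((1 - h) * x ord0 i) ^+ 2 / (1 + 2 * - 8^-1 * Num.sqrt (2 * h) ^+ 2)).
apply: (@le_trans _ _ (\int[lam]_g (\prod_i (normal_pdf 0 1 (g ord0 i) * b i (g ord0 i)))%:E)%E).
  apply: ge0_le_integralT => g.
    rewrite lee_fin mulr_ge0 ?gauss_density_ge0//.
    by have /andP[a0 a1] := mala_accept_01 h f x (mala_prop h f x g);
      rewrite addr_ge0// mulr_ge0 ?expR_ge0// subr_ge0.
  rewrite lee_fin big_split/= -gauss_densityE ler_wpM2l ?gauss_density_ge0//.
  apply: le_trans (step g) _; rewrite /b -expR_sum ler_expR /sqnorm.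
  rewrite mulr_suml; apply: ler_sum => i _; rewrite yE opprK mulrC.
  exact: lexx.
have mb i : measurable_fun setT (b i).
  apply: measurableT_comp => //; apply: measurable_funM => //.
  apply: measurable_funX; apply: measurable_funD => //; exact: measurable_funM.
rewrite (@integral_prod_coord _ _ lam (fun i t => normal_pdf 0 1 t * b i t) c)//; last 4 first.
- by move=> i; apply: measurable_funM => //; exact: measurable_normal_pdf.
- by move=> i t; rewrite mulr_ge0 ?expR_ge0 ?normal_pdf_ge0.
- by move=> i; rewrite mulr_gt0 ?expR_gt0// invr_gt0 sqrtr_gt0.
- by move=> i; exact: integral_normal_pdf_expR_sqr.
rewrite lee_fin (_ : expR _ * _ = \prod_i (expR (h / 2) * expR (x ord0 i ^+ 2 / 8))); last first.
  rewrite big_split/= prodr_const card_ord -expRM_natl -expR_sum; congr (expR _ * expR _).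
    by ring.
  by rewrite /sqnorm mulr_suml.
have qE : 1 + 2 * - 8^-1 * Num.sqrt (2 * h) ^+ 2 = 1 - h / 2.
  by rewrite sqr_sqrtr ?mulr_ge0 ?(ltW h0)//; field.
apply: ler_prod => i _; rewrite /c qE in q0 *.
apply/andP; split; first by rewrite mulr_ge0 ?expR_ge0// invr_ge0 sqrtr_ge0.
apply: ler_pM; rewrite ?expR_ge0 ?invr_ge0 ?sqrtr_ge0//.
  (* Squared, this is [exp(-h) <= 1 - h / 2], which follows from [exp(-h) <= 1 / (1 + h)] for
     [0 < h <= 1]. *)
  rewrite -[leRHS]invrK -expRN lef_pV2 ?posrE ?expR_gt0 ?sqrtr_gt0//.
  rewrite -(@ler_pXn2r _ 2)// ?nnegrE ?sqrtr_ge0 ?expR_ge0// sqr_sqrtr ?(ltW q0)//.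
  rewrite -expRM_natl (_ : 2%:R * - (h / 2) = - h); last by field.
  have := expR_onem_le1 (- h); have := expR_ge0 (- h); rewrite opprK; nra.
(* This is [(1 - h)^2 <= 1 - h / 2] on [(0, 1]]. *)
rewrite ler_expR ler_pdivrMr// opprK.
have : 0 <= x ord0 i ^+ 2 by exact: sqr_ge0.
rewrite exprMn; nra.
Qed.

Lemma ge0_markov (R : realType) n (Q : {measure set 'rV[R]_n -> \bar R}) (V : 'rV[R]_n -> R)
    (B : set 'rV[R]_n) (c u : R) :
  measurable B -> (forall x, 0 <= V x) -> (forall x, B x -> 1 <= c * V x) -> 0 <= c ->
  measurable_fun setT V -> (\int[Q]_x (V x)%:E <= u%:E)%E -> (Q B <= (c * u)%:E)%E.
Proof.
move=> mB V0 BV c0 mV Vu.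
apply: (@le_trans _ _ (c%:E * \int[Q]_x (V x)%:E)%E); last first.
  by rewrite EFinM; apply: lee_wpmul2l.
have mEV : measurable_fun setT (fun x => (V x)%:E) by exact/measurable_EFinP.
rewrite -ge0_integralZl_EFin//; last by move=> x _; rewrite lee_fin.
rewrite -[X in Q X]setIT -integral_indic//; apply: ge0_le_integralT => x.
  by rewrite lee_fin indicE.
rewrite -EFinM lee_fin indicE; case: (boolP (x \in B)) => [|_].
  by rewrite inE; exact: BV.
by rewrite mulr_ge0.
Qed.

(** The start has [sqnorm x <= n / 2] while the target has mean [sqnorm] equal to [n]; the level
    [3 n / 4] separates them. Exponential Markov bounds give the chain mass at least [3/4], and the
    target mass at most [1/4], below that level. *)
Lemma mala_small_step (R : realType) n (lam : {measure set 'rV[R]_n -> \bar R}) (h k : R) :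
  is_lebesgue lam -> 0 < h <= 1 -> 1 <= k ->
  (129 / 130) ^+ n <= 4^-1 :> R -> expR (- (n%:R / 64)) <= 4^-1 :> R ->
  exists (f : 'rV[R]_n -> R) (pi0 : probability 'rV[R]_n R),
    twice_differentiable f /\ hessian_bounded f k /\
    density_bounded (target lam f) pi0 (expR n%:R) /\
    forall T : nat, T%:R * h <= 32^-1 ->
      ((expR (-1))%:E < tv_dist (mala_law lam h f pi0 T) (target lam f))%E.
Proof.
move=> hlam h01 k1 n1 n2; have /andP[h0 h1] := h01.
pose phi := fun (_ : 'I_n) => quad (1 : R).
pose f : 'rV[R]_n -> R := separable phi.
have Hphi (i : 'I_n) (t : R) : is_derive t 1 (phi i) (dquad 1 t) by exact: is_derive_quad.
have Hdphi (i : 'I_n) (t : R) : is_derive t 1 (dquad 1) (1 : R) by exact: is_derive_dquad.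
have mphi i : measurable_fun setT (phi i) by exact: measurable_quad.
pose Z := Num.sqrt (2 * pi / 1) : R.
have HZ (i : 'I_n) : (\int[lebesgue_measure]_t (expR (- phi i t))%:E = Z%:E)%E.
  exact: integral_expR_sqr.
have Z0 : 0 < Z by rewrite sqrtr_gt0 divr1 mulr_gt0// pi_gt0.
have [P [PE PP]] := target_probability hlam mphi (fun=> Z0) HZ.
have [q [q0 Hq qZ1 _]] := quad_window_mass (@ltr01 R).
set w := Num.sqrt _ in Hq.
have mW := measurable_window (fun _ : 'I_n => w).
have POm : P (window (fun _ : 'I_n => w)) = ((q / Z) ^+ n)%:E.
  rewrite -[X in P X]setIT -integral_indic//.
  rewrite (_ : (q / Z) ^+ n = \prod_(i < n) (q / Z)); last by rewrite prodr_const card_ord.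
  rewrite -(PP (fun i => \1_(`[- w, w]%classic : set R)) (fun=> q))//.
  by apply: eq_integral => x _; rewrite window_indic.
have p0 : 0 < (q / Z) ^+ n by rewrite exprn_gt0// divr_gt0.
have pM : ((q / Z) ^+ n)^-1 <= expR n%:R.
  rewrite -[leRHS]invrK -expRN lef_pV2 ?posrE ?expR_gt0//.
  apply: (@le_trans _ _ (expR (- (49 / 50)) ^+ n)); last first.
    by apply: lerXn2r; rewrite ?nnegrE ?expR_ge0// divr_ge0 ?ltW.
  rewrite -expRM_natl ler_expR; have : 0 <= n%:R :> R by [].
  lra.
have [pi0 [Hdens _ pi0V]] := warm_start PE mW POm p0 pM.
exists f, pi0; split; first exact: twice_differentiable_separable Hphi Hdphi.
split; first by apply: hessian_bounded_separable Hphi Hdphi _ => i t; rewrite lexx.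
split=> // T HT.
pose V (x : 'rV[R]_n) := expR (sqnorm x / 8).
have mV : measurable_fun setT V.
  by apply: measurableT_comp => //; apply: measurable_funM => //; exact: measurable_sqnorm.
have V0 x : 0 <= V x by exact: expR_ge0.
have [Q [QE QV]] := mala_law_drift pi0 T hlam (measurable_separable Hphi)
  (measurable_grad_separable Hphi Hdphi) mV V0 (expR_ge0 (h * n%:R / 2))
  (fun x => integral_drift_quad x hlam h01 (erefl f)).
have QV2 : (\int[Q]_x (V x)%:E <= (expR (T%:R * (h * n%:R / 2) + n%:R / 16))%:E)%E.
  apply: le_trans QV _; rewrite -expRM_natl expRD EFinM; apply: lee_wpmul2l.
    by rewrite lee_fin expR_ge0.
  apply: pi0V => //.
  move=> x Wx; rewrite ler_expR /sqnorm.
  rewrite (_ : n%:R / 16 = (\sum_(i < n) 2^-1) / 8); last first.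
    by rewrite sumr_const card_ord -mulr_natl; field.
  rewrite ler_wpM2r// ; apply: ler_sum => i _.
  by rewrite -(mul1r (_ ^+ 2)); apply: quad_window => //; have := Wx i; rewrite in_itv.
pose B := [set x : 'rV[R]_n | sqnorm x < 3 / 4 * n%:R].
have mB : measurable B.
  have := @measurable_sqnorm R n measurableT _ (measurable_itv `]-oo, (3 / 4 * n%:R)[).
  by rewrite setTI; congr measurable; apply/seteqP; split => x; rewrite /B/= in_itv.
(* With [T h <= 1/32] the exponent is at most [n (-3/32 + 1/64 + 1/16) = -n / 64]. *)
have QBc : (Q (~` B) <= (expR (- (3 / 32 * n%:R)) * expR (T%:R * (h * n%:R / 2) + n%:R / 16))%:E)%E.
  apply: (@ge0_markov _ _ Q V) => //; first exact: measurableC.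
  move=> x /negP; rewrite -leNgt => xB.
  by rewrite /V -expRD -[leLHS]expR0 ler_expR; lra.
(* Tilting by [exp(-sqnorm x / 8)] raises the precision from [1] to [5/4], so each coordinate costs
   [exp(3/32) sqrt(4/5)]. Its square is at most [16/13 * 4/5 = 64/65], below [(129/130)^2]. *)
have PB : (P B <= ((129 / 130) ^+ n)%:E)%E.
  pose U (x : 'rV[R]_n) := expR (- (sqnorm x / 8)).
  have mU : measurable_fun setT U.
    by apply: measurableT_comp => //; apply: measurable_funN; apply: measurable_funM => //; exact: measurable_sqnorm.
  pose Z' := Num.sqrt (2 * pi / (5 / 4)) : R.
  have PU : (\int[P]_x (U x)%:E = (\prod_(i < n) (Z' / Z))%:E)%E.
    rewrite -(PP (fun i t => expR (- (t ^+ 2 / 8))) (fun=> Z'))//.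
    + by apply: eq_integral => x _; rewrite /U -expR_sum sumrN -mulr_suml.
    + move=> i; apply: measurableT_comp => //; apply: measurable_funN.
      by apply: measurable_funM => //; exact: measurable_funX.
    + by move=> i; rewrite sqrtr_gt0 divr_gt0 ?mulr_gt0 ?pi_gt0.
    + move=> i; rewrite -integral_expR_sqr ?divr_gt0//.
      apply: eq_integral => t _; rewrite -expRD; congr (expR _)%:E.
      by rewrite /phi /quad; field.
  have := @ge0_markov _ _ P U B (expR (3 / 32 * n%:R)) (\prod_(i < n) (Z' / Z)) mB (fun=> expR_ge0 _) _ (expR_ge0 _) mU.
  rewrite PU => /(_ _ (lexx _)) PB.
  apply: le_trans (PB _) _.
    by move=> x xB; rewrite /U -expRD -[leLHS]expR0 ler_expR; rewrite /B/= in xB; lra.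
  rewrite lee_fin prodr_const card_ord.
  rewrite (_ : 3 / 32 * n%:R = n%:R * (3 / 32)); last by ring.
  rewrite expRM_natl -exprMn.
  apply: lerXn2r; rewrite ?nnegrE ?mulr_ge0 ?expR_ge0 ?invr_ge0 ?sqrtr_ge0//.
  rewrite -(@ler_pXn2r _ 2)// ?nnegrE ?mulr_ge0 ?expR_ge0 ?invr_ge0 ?sqrtr_ge0//.
  rewrite exprMn -expRM_natl exprMn exprVn !sqr_sqrtr ?divr_ge0 ?mulr_ge0 ?pi_ge0//.
  have -> : 2 * pi / (5 / 4) / (2 * pi / 1) = 4 / 5 :> R.
    by move: (pi : R) (@pi_gt0 R) => p p_gt0; field; exact: lt0r_neq0.
  have := expR_onem_le1 (2%:R * (3 / 32) : R); rewrite expr2; lra.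
have QB : ((3 / 4)%:E <= Q B)%E.
  have : (Q (~` B) <= (4^-1)%:E)%E.
    apply: le_trans QBc _; rewrite lee_fin -expRD; apply: le_trans n2.
    rewrite ler_expR; have : 0 <= n%:R :> R by [].
    set N := n%:R; set TT := T%:R in HT *; nra.
  rewrite probability_setC// -(fineK (fin_num_measure Q B mB)) -EFinB !lee_fin.
  lra.
have tv := le_tv_dist (mala_law lam h f pi0 T) (target lam f) mB.
apply: lt_le_trans tv; rewrite PE// QE//.
apply: (@lt_le_trans _ _ (2^-1)%:E); first by rewrite lte_fin; exact: expRN1_lt_half.
apply: le_trans (lee_abs _).
apply: (@le_trans _ _ ((3 / 4)%:E - (4^-1)%:E)%E); first by rewrite -EFinB lee_fin; lra.
by apply: leeB => //; apply: le_trans PB _; rewrite lee_fin.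
Qed.

(** All coordinates are alike: each has window mass between [exp(-49/50)] and [3/4], and acceptance
    factor at most [19/20] because [h k >= 1]. *)
Lemma mala_large_step (R : realType) n (lam : {measure set 'rV[R]_n -> \bar R}) (h k : R) :
  is_lebesgue lam -> 0 < h -> 1 <= k -> 1 <= h * k -> (3 / 4) ^+ n <= 4^-1 :> R ->
  exists (f : 'rV[R]_n -> R) (pi0 : probability 'rV[R]_n R),
    twice_differentiable f /\ hessian_bounded f k /\
    density_bounded (target lam f) pi0 (expR n%:R) /\
    forall T : nat, T%:R * (19 / 20) ^+ n <= 4^-1 :> R ->
      ((expR (-1))%:E < tv_dist (mala_law lam h f pi0 T) (target lam f))%E.
Proof.
move=> hlam h0 k1 hk n1.
have k0 : 0 < k by lra.
have [q [q0 Hq qZ1 qZ2]] := quad_window_mass k0.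
set w := Num.sqrt _ in Hq; set Z := Num.sqrt _ in qZ1 qZ2.
have Z0 : 0 < Z by rewrite sqrtr_gt0 divr_gt0// mulr_gt0// pi_gt0.
apply: (@mala_stuck _ _ lam h k (fun=> quad k) (fun=> dquad k) (fun _ _ => k)
  (fun=> Z) (fun=> w) (fun=> q) (fun=> 19 / 20) ((19 / 20) ^+ n)) => //.
- by move=> i t; exact: is_derive_quad.
- by move=> i t; exact: is_derive_dquad.
- by move=> i t; rewrite k1 lexx.
- by move=> i; exact: integral_expR_sqr.
- rewrite prodr_const card_ord; apply/andP; split.
    apply: (@le_trans _ _ (expR (- (49 / 50)) ^+ n)).
      by rewrite -expRM_natl ler_expR; have : 0 <= n%:R :> R by []; lra.
    by apply: lerXn2r; rewrite ?nnegrE ?expR_ge0// divr_ge0 ?ltW.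
  by apply: le_trans n1; apply: lerXn2r; rewrite ?nnegrE ?divr_ge0 ?(ltW q0) ?(ltW Z0).
- move=> i x; rewrite in_itv => /quad_window => /(_ k0) kx.
  have [b [c [mb bb c0 [_ /(_ hk) c1] Hc]]] := integral_accept_quad h0 k0 kx.
  by exists b, c; split=> //; rewrite c0.
- by rewrite prodr_const card_ord.
- by rewrite exprn_ge0 ?divr_ge0// exprn_ile1 ?divr_ge0//; lra.
Qed.

(** Comparison with the Gaussian of precision [k / 2] gives [Z <= 4 / sqrt k], and [phi <= 1] on the
    window gives [q >= w / 2]. The quotient is of order [H sqrt H], and [sqrt H >= H] as
    [H <= 1]. *)
Lemma hard_window_mass (R : realType) (h k : R) : 0 < h -> 0 < k -> h * k <= 1 ->
  let phi := hard (k / 2) (k / 4) h in let w := h * k / (64 * 96) * Num.sqrt h in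
  exists q Z, [/\ 0 < q, 0 < Z,
    (\int[lebesgue_measure]_t (expR (- phi t))%:E = Z%:E)%E,
    (\int[lebesgue_measure]_t (expR (- phi t) * \1_(`[- w, w]%classic : set R) t)%:E = q%:E)%E &
    (h * k) ^+ 2 / (512 * 96) <= q / Z <= 1].
Proof.
move=> h0 k0 hk1 phi w.
have hk0 : 0 < h * k by exact: mulr_gt0.
set H := h * k in hk1 hk0 w *.
have s0 : 0 < Num.sqrt h by rewrite sqrtr_gt0.
have s2 : Num.sqrt h ^+ 2 = h by rewrite sqr_sqrtr// ltW.
have sk0 : 0 < Num.sqrt k by rewrite sqrtr_gt0.
have w0 : 0 < w by rewrite mulr_gt0//; lra.
have mphi : measurable_fun setT phi.
  by apply: (measurable_of_is_derive (dphi := dhard (k / 2) (k / 4) h)) => t; exact: is_derive_hard.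
have pos (t : R) : 0 < h + t ^+ 2 by rewrite ltr_pwDl// sqr_ge0.
have frac (t : R) : 0 <= h * (t ^+ 2 / (h + t ^+ 2)) <= t ^+ 2.
  have t0 : 0 <= t ^+ 2 by exact: sqr_ge0.
  rewrite mulr_ge0 ?divr_ge0 ?(ltW h0) ?(ltW (pos t))//= mulrA ler_pdivrMr//.
  by rewrite mulrC mulrDr lerDl mulr_ge0.
have phiE t : phi t = k * (t ^+ 2 / 4 + h * (t ^+ 2 / (h + t ^+ 2)) / 8).
  by rewrite /phi /hard; field; rewrite gt_eqF.
have phi1 t : k / 2 * t ^+ 2 / 2 <= phi t.
  rewrite phiE; have /andP[f0 _] := frac t; nra.
have phi0 t : 0 <= phi t.
  by apply: le_trans (phi1 t); rewrite divr_ge0// mulr_ge0 ?sqr_ge0// divr_ge0// ltW.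
have [q [/andP[q1 q2] Hq]] : exists q, 2 * w * expR (- 1) <= q <= 2 * w /\
    (\int[lebesgue_measure]_t (expR (- phi t) * \1_(`[- w, w]%classic : set R) t)%:E = q%:E)%E.
  apply: integral_expR_window => // t tw.
  have tw2 : t ^+ 2 <= w ^+ 2.
    by rewrite -(real_normK (num_real t)) ler_pXn2r// ?nnegrE ?(ltW w0)// ler_norml.
  have wh : k * w ^+ 2 <= 1.
    rewrite exprMn s2 (_ : k * _ = (H / (64 * 96)) ^+ 2 * H); last by rewrite /H; ring.
    have h1 : 0 <= H / (64 * 96) <= 1 by apply/andP; split; lra.
    by case/andP: h1 => ? ?; rewrite mulr_ile1 ?sqr_ge0 ?(ltW hk0)// exprn_ile1.
  rewrite phiE; have /andP[_ f1] := frac t.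
  have : k * t ^+ 2 <= 1 by apply: le_trans wh; rewrite ler_wpM2l// ltW.
  nra.
have e1 : 4^-1 <= expR (- 1) :> R.
  have := expR_ge1Dx (- 2^-1 : R).
  rewrite (_ : - 1 = 2%:R * - 2^-1 :> R); last by field.
  by rewrite expRM_natl expr2 => ?; nra.
have q0 : 0 < q by apply: lt_le_trans q1; rewrite !mulr_gt0 ?expR_gt0.
have k2 : 0 < k / 2 by rewrite divr_gt0.
set I := (\int[lebesgue_measure]_t (expR (- phi t))%:E)%E.
have I1 : (I <= (Num.sqrt (2 * pi / (k / 2)))%:E)%E.
  rewrite -integral_expR_sqr//; apply: ge0_le_integralT => t.
    by rewrite lee_fin expR_ge0.
  by rewrite lee_fin ler_expR lerN2.
have I2 : (q%:E <= I)%E.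
  rewrite -Hq; apply: ge0_le_integralT => t.
    by rewrite lee_fin mulr_ge0 ?expR_ge0// indicE.
  by rewrite lee_fin ler_piMr ?expR_ge0// indicE; case: (_ \in _).
have Ifin : I \is a fin_num.
  rewrite ge0_fin_numE; first by rewrite (le_lt_trans I1)// ltry.
  by apply: le_trans I2; rewrite lee_fin ltW.
exists q, (fine I); rewrite fineK//.
move: I1 I2; rewrite -(fineK Ifin) !lee_fin; set Z := fine I => I1 I2.
have Z0 : 0 < Z by exact: lt_le_trans I2.
split=> //; apply/andP; split; last by rewrite ler_pdivrMr// mul1r.
rewrite /= ler_pdivlMr//.
have Z4 : Z * Num.sqrt k <= 4.
  apply: (@le_trans _ _ (Num.sqrt (2 * pi / (k / 2)) * Num.sqrt k)).
    by rewrite ler_wpM2r// ltW.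
  rewrite -sqrtrM ?divr_ge0 ?mulr_ge0 ?pi_ge0 ?(ltW k0)//.
  rewrite (_ : _ * k = 4 * pi); last by field; rewrite gt_eqF.
  rewrite -(@ler_pXn2r _ 2)// ?nnegrE ?sqrtr_ge0// sqr_sqrtr ?mulr_ge0 ?pi_ge0//.
  by have := @pihalf_lt2 R; rewrite ltr_pdivrMr// expr2 => ?; lra.
have hn : 0 <= h by exact: ltW.
have kn : 0 <= k by exact: ltW.
have sE : Num.sqrt h * Num.sqrt k = Num.sqrt H by rewrite -sqrtrM.
have sH : H <= Num.sqrt h * Num.sqrt k.
  rewrite sE -(@ler_pXn2r _ 2)// ?nnegrE ?sqrtr_ge0 ?(ltW hk0)//.
  by rewrite sqr_sqrtr ?(ltW hk0)// expr2 ler_piMl// ltW.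
have q3 : H / (128 * 96) * Num.sqrt h <= q.
  apply: le_trans q1.
  rewrite (_ : H / (128 * 96) * Num.sqrt h = 2 * w * 4^-1); last by rewrite /w; field.
  by rewrite ler_wpM2l// mulr_ge0// ltW.
have : H * (H * Z) <= H * (Num.sqrt h * 4).
  rewrite ler_wpM2l ?(ltW hk0)//.
  apply: (@le_trans _ _ (Num.sqrt h * Num.sqrt k * Z)); first by rewrite ler_wpM2r// ltW.
  by rewrite -mulrA (mulrC _ Z) ler_wpM2l.
lra.
Qed.

Lemma prod_ltn_if (R : realType) n m (a b : R) : (m <= n)%N ->
  \prod_(i < n) (if (i < m)%N then a else b) = a ^+ m * b ^+ (n - m).
Proof.
move=> mn; rewrite -(big_mkord xpredT (fun i => if (i < m)%N then a else b)).
rewrite (big_cat_nat (n := m))//=; congr (_ * _).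
  rewrite big_nat (eq_bigr (fun=> a)); last by move=> i /andP[_ ->].
  by rewrite -big_nat prodr_const_nat subn0.
rewrite big_nat (eq_bigr (fun=> b)); last by move=> i /andP[mi _]; rewrite ltnNge mi.
by rewrite -big_nat prodr_const_nat.
Qed.

(** The first [m] coordinates are bent and make acceptance rare. The remaining Gaussian ones, with
    acceptance factor at most one, bring the window mass below [1/4], the mass of a bent window
    being bounded above only by one. *)
Lemma mala_mid_step (R : realType) n m (lam : {measure set 'rV[R]_n -> \bar R}) (h k : R) :
  is_lebesgue lam -> 0 < h -> 10 <= k -> h * k <= 1 -> (m <= n)%N ->
  (3 / 4) ^+ (n - m) <= 4^-1 :> R ->
  expR (- n%:R) <= ((h * k) ^+ 2 / (512 * 96)) ^+ m * expR (- (49 / 50)) ^+ (n - m) ->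
  exists (f : 'rV[R]_n -> R) (pi0 : probability 'rV[R]_n R),
    twice_differentiable f /\ hessian_bounded f k /\
    density_bounded (target lam f) pi0 (expR n%:R) /\
    forall T : nat, T%:R * expR (- (h * k / (64 * 96))) ^+ m <= 4^-1 ->
      ((expR (-1))%:E < tv_dist (mala_law lam h f pi0 T) (target lam f))%E.
Proof.
move=> hlam h0 k10 hk1 mn n1 n2.
have k0 : 0 < k by lra.
have hk0 : 0 < h * k by exact: mulr_gt0.
have [q1 [q10 Hq1 qZ1 qZ2]] := quad_window_mass (@ltr01 R).
set w1 := Num.sqrt _ in Hq1; set Z1 := Num.sqrt _ in qZ1 qZ2.
have Z10 : 0 < Z1 by rewrite sqrtr_gt0 divr1 mulr_gt0// pi_gt0.
have [q2 [Z2 [q20 Z20 HZ2 Hq2 /andP[qZ3 qZ4]]]] := hard_window_mass h0 k0 hk1.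
set w2 := h * k / (64 * 96) * Num.sqrt h in Hq2.
have [D D0 DE] : exists2 D, 0 <= D & D = (h * k) ^+ 2 / (512 * 96).
  by exists ((h * k) ^+ 2 / (512 * 96)); [have := sqr_ge0 (h * k); lra|].
rewrite -DE in n2 qZ3.
have qZ2n : 0 <= q2 / Z2 by rewrite divr_ge0 ?ltW.
have qZ1n : 0 <= q1 / Z1 by rewrite divr_ge0 ?ltW.
pose sel T (x y : T) (i : 'I_n) := if (i < m)%N then x else y.
apply: (@mala_stuck _ _ lam h k
  (sel _ (hard (k / 2) (k / 4) h) (quad 1))
  (sel _ (dhard (k / 2) (k / 4) h) (dquad 1))
  (sel _ (ddhard (k / 2) (k / 4) h) (fun=> 1))
  (sel _ Z2 Z1) (sel _ w2 w1) (sel _ q2 q1)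
  (sel _ (expR (- (h * k / (64 * 96)))) 1) (expR (- (h * k / (64 * 96))) ^+ m)) => //.
- by move=> i t; rewrite /sel; case: ifP => _; [exact: is_derive_hard|exact: is_derive_quad].
- by move=> i t; rewrite /sel; case: ifP => _; [exact: is_derive_dhard|exact: is_derive_dquad].
- move=> i t; rewrite /sel; case: ifP => _; last by rewrite lexx; lra.
  have /andP[d1 d2] := @ddhard_bounds R (k / 2) (k / 4) h t h0 ltac:(by rewrite divr_ge0// ltW).
  by apply/andP; split; lra.
- by move=> i; rewrite /sel; case: ifP.
- by move=> i; rewrite /sel; case: ifP.
- by move=> i; rewrite /sel; case: ifP => _ //; exact: integral_expR_sqr.
- by move=> i; rewrite /sel; case: ifP.
- rewrite (eq_bigr (fun i : 'I_n => if (i < m)%N then q2 / Z2 else q1 / Z1)); last first.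
    by move=> i _; rewrite /sel; case: ifP.
  rewrite prod_ltn_if//; apply/andP; split.
    apply: le_trans n2 _; apply: ler_pM; rewrite ?exprn_ge0 ?expR_ge0//.
      by apply: lerXn2r; rewrite ?nnegrE.
    by apply: lerXn2r; rewrite ?nnegrE ?expR_ge0.
  apply: le_trans n1; rewrite -[leRHS]mul1r.
  apply: ler_pM; rewrite ?exprn_ge0//.
    by rewrite exprn_ile1.
  by apply: lerXn2r; rewrite ?nnegrE//; lra.
- move=> i x; rewrite in_itv /sel; case: ifP => _ xw.
    exact: integral_accept_hard.
  have [b [c [mb bb c0 [c1 _] Hc]]] := integral_accept_quad h0 ltr01 (quad_window ltr01 xw).
  by exists b, c; split=> //; rewrite c0.
- by rewrite /sel prod_ltn_if// expr1n mulr1.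
- by rewrite exprn_ge0 ?expR_ge0// exprn_ile1 ?expR_ge0// -[leRHS]expR0 ler_expR oppr_le0; lra.
Qed.

(** * Numerical inequalities *)

Lemma onem_expn_le_expR (R : realType) (q : R) n : q <= 1 ->
  (1 - q) ^+ n <= expR (- (q * n%:R)).
Proof.
move=> q1; rewrite (_ : - (q * n%:R) = n%:R * - q); last by ring.
rewrite expRM_natl; apply: lerXn2r; rewrite ?nnegrE ?expR_ge0 ?subr_ge0//.
exact: expR_ge1Dx.
Qed.

Lemma expRN_le_quarter (R : realType) (x : R) : 3 <= x -> expR (- x) <= 4^-1.
Proof.
move=> x3; rewrite expRN lef_pV2 ?posrE ?expR_gt0//.
by have := expR_ge1Dx x; lra.
Qed.

(** Write [exp(D / 20)] as the sixth power of [exp(D / 120) >= D / 120]; one factor [D] then absorbs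
    [120^6]. *)
Lemma pow5_le_expR (R : realType) (D : R) : 0 < D -> 120 ^+ 6 <= D ->
  D ^+ 5 <= expR (20^-1 * D).
Proof.
move=> D0 DK.
rewrite (_ : 20^-1 * D = 6%:R * (D / 120)); last by field.
rewrite expRM_natl; apply: (@le_trans _ _ ((D / 120) ^+ 6)); last first.
  apply: lerXn2r; rewrite ?nnegrE ?expR_ge0 ?divr_ge0 ?(ltW D0)//.
  by have := expR_ge1Dx (D / 120); lra.
have K0 : 0 < 120 ^+ 6 :> R by rewrite exprn_gt0.
rewrite exprMn exprVn ler_pdivlMr// [leRHS]exprS mulrC ler_wpM2r//.
by rewrite exprn_ge0// ltW.
Qed.

(** Same device with a square: [exp(D / 100) >= (D / 200)^2 >= D]. It makes room for at least one
    bent coordinate. *)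
Lemma mul100_ln_le (R : realType) (D : R) : 0 < D -> 200 * 200 <= D -> 100 * ln D <= D.
Proof.
move=> D0 DK; rewrite -ler_pdivlMl// -ler_expR lnK ?posrE//.
rewrite (_ : 100^-1 * D = 2%:R * (D / 200)); last by field.
rewrite expRM_natl; have e := expR_ge1Dx (D / 200).
apply: (@le_trans _ _ ((D / 200) ^+ 2)); last first.
  by apply: lerXn2r; rewrite ?nnegrE ?expR_ge0 ?divr_ge0 ?(ltW D0)//; lra.
nra.
Qed.

(** Each bent window keeps target mass at least [D^(-2)]. *)
Lemma hard_mass_numerics (R : realType) (C H D : R) :
  512 * 96 <= C ^+ 2 -> 0 <= C <= H * D -> 1 <= H ^+ 2 / (512 * 96) * D ^+ 2.
Proof.
move=> C2 /andP[C0 CHD].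
have : C ^+ 2 <= (H * D) ^+ 2 by rewrite ler_pXn2r ?nnegrE// (le_trans C0).
rewrite exprMn; lra.
Qed.

(** Warmness budget: bent coordinates cost [2 L] each, Gaussian ones [49/50]. With [m L <= D / 100]
    the bent ones use at most the spare [D / 50]. *)
Lemma hard_count_numerics (R : realType) (D L m : R) : 0 <= m -> m * (100 * L) <= D ->
  - D <= m * - (2 * L) + (D - m) * - (49 / 50).
Proof. move=> m0 mL; lra. Qed.

(** The quotient [1200 / 200 = 6] is the power of [1 / D] bounding the acceptance, one more than the
    power in the time horizon. *)
Lemma hard_accept_numerics (R : realType) (H L m : R) : 0 < L ->
  1200 * (64 * 96) * L ^+ 2 <= H * (m * (200 * L)) ->
  m * - (H / (64 * 96)) <= 6 * - L.
Proof.
move=> L0 hh.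
have : 1200 * (64 * 96) * L <= H * (m * 200).
  by rewrite -(@ler_pM2r _ L)//; lra.
lra.
Qed.

(** * Choice of constants and case split on the step size *)

Theorem theorem3 (R : realType) :
  exists (c : R) (d0 : nat), 0 < c /\
  forall (d : nat) (kappa h : R),
    (d0 <= d)%N -> 10 <= kappa <= d%:R ^+ 4 -> 0 < h ->
  forall lam : {measure set 'rV[R]_d -> \bar R}, is_lebesgue lam ->
  exists (f : 'rV[R]_d -> R) (pi0 : probability 'rV[R]_d R),
    twice_differentiable f /\ hessian_bounded f kappa /\
    density_bounded (target lam f) pi0 (expR d%:R) /\
    forall T : nat, T%:R <= c * kappa * d%:R / (ln d%:R) ^+ 2 ->
      ((expR (-1))%:E < tv_dist (mala_law lam h f pi0 T) (target lam f))%E.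
Proof.
(* [C] marks the border between small and medium steps; only these three properties of it are used,
   so its value stays hidden. *)
have [C [C1 Cmass Caccept]] : exists C : R, [/\ 32 <= C,
    forall H D, C <= H * D -> 1 <= H ^+ 2 / (512 * 96) * D ^+ 2 &
    forall H L m, 0 < L -> C * L ^+ 2 <= H * (m * (200 * L)) ->
      m * - (H / (64 * 96)) <= 6 * - L].
  exists (1200 * (64 * 96)); split; first by lra.
    move=> H D CHD; apply: (hard_mass_numerics (C := 1200 * (64 * 96))); first by nra.
    by rewrite CHD andbT; lra.
  exact: hard_accept_numerics.
have C0 : 0 < C by lra.
(* The constant turns [h kappa D <= C L^2] into [T h <= 1/32]; the threshold on [d] exceeds both
   [120^6] and [200^2]. *)
exists (32 * C)^-1, (Num.truncn (120 ^+ 6 + 200 * 200 : R)).+1.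
split; first by rewrite invr_gt0; lra.
move=> d kappa h dd /andP[k10 kd] h0 lam hlam.
set D := d%:R in kd *.
have K0 : 0 <= 120 ^+ 6 :> R by rewrite exprn_ge0.
have DK : 120 ^+ 6 + 200 * 200 <= D.
  apply: le_trans (ltW (truncnS_gt _)) _.
  by rewrite ler_nat.
have D1 : 200 * 200 <= D by apply: le_trans DK; rewrite lerDr.
have D2 : 120 ^+ 6 <= D.
  apply: le_trans DK; rewrite lerDl; lra.
have D0 : 0 < D by lra.
have Dge1 : 1 <= D by lra.
have lnD := mul100_ln_le D0 D1.
have D5 := pow5_le_expR D0 D2.
clear dd DK D2 K0.
set L := ln D in lnD *.
have L1 : 1 <= L.
  rewrite -ler_expR lnK ?posrE//.
  have -> : expR 1 = expR (2^-1) ^+ 2 :> R by rewrite -expRM_natl; congr expR; field.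
  by have := expR_onem_le1 (2^-1 : R); have := expR_ge0 (2^-1 : R); rewrite expr2; nra.
have L2 : 1 <= L ^+ 2 by rewrite exprn_ege1.
have k1 : 1 <= kappa by lra.
have k0 : 0 < kappa by lra.
(* As [kappa <= D^4] and [L^2 >= 1], the horizon is polynomial in [D]; the medium and large regimes
   use only this. *)
have TD (T : nat) : T%:R <= (32 * C)^-1 * kappa * D / L ^+ 2 ->
    T%:R <= (32 * C)^-1 * D ^+ 5.
  move=> hT; apply: le_trans hT _.
  rewrite -!mulrA ler_wpM2l ?invr_ge0 ?mulr_ge0 ?(ltW C0)//.
  rewrite mulrA ler_pdivrMr ?(lt_le_trans ltr01)//.
  rewrite (exprSr D 4) -mulrA; apply: ler_pM => //; rewrite ?mulr_ge0 ?(ltW D0) ?(ltW k0)//.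
  by rewrite ler_peMr// ltW.
have C32 : 0 <= (32 * C)^-1 by rewrite invr_ge0 mulr_ge0// ltW.
have C4 : (32 * C)^-1 <= 4^-1.
  by rewrite lef_pV2 ?posrE; lra.
have [hk1|hk1] := ltP 1 (h * kappa).
  have n1 : (3 / 4) ^+ d <= 4^-1 :> R.
    rewrite (_ : 3 / 4 = 1 - 4^-1 :> R); last by field.
    apply: le_trans (onem_expn_le_expR d _) _; first by lra.
    by apply: expRN_le_quarter; rewrite -/D; lra.
  have [f [pi0 [H1 [H2 [H3 H4]]]]] := mala_large_step hlam h0 k1 (ltW hk1) n1.
  exists f, pi0; split=> //; split=> //; split=> // T /TD HT; apply: H4.
  apply: (@le_trans _ _ ((32 * C)^-1 * D ^+ 5 * (19 / 20) ^+ d)).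
    by rewrite ler_wpM2r// exprn_ge0// divr_ge0.
  have e : D ^+ 5 * (19 / 20) ^+ d <= 1.
    rewrite (_ : 19 / 20 = 1 - 20^-1 :> R); last by field.
    apply: (@le_trans _ _ (expR (20^-1 * D) * expR (- (20^-1 * D)))).
      apply: ler_pM; rewrite ?exprn_ge0 ?(ltW D0)//; first by lra.
      by apply: onem_expn_le_expR; lra.
    by rewrite -expRD subrr expR0.
  rewrite -mulrA; apply: le_trans C4; rewrite ler_piMr// invr_ge0; lra.
have [hC|hC] := leP (h * kappa * D) (C * L ^+ 2).
  have h1 : h <= 1 by apply: le_trans hk1; rewrite ler_peMr// ltW.
  have n1 : (129 / 130) ^+ d <= 4^-1 :> R.
    rewrite (_ : 129 / 130 = 1 - 130^-1 :> R); last by field.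
    apply: le_trans (onem_expn_le_expR d _) _; first by lra.
    by apply: expRN_le_quarter; rewrite -/D; lra.
  have n2 : expR (- (d%:R / 64)) <= 4^-1 :> R.
    by apply: expRN_le_quarter; rewrite -/D; lra.
  have h01 : 0 < h <= 1 by rewrite h0.
  have [f [pi0 [H1 [H2 [H3 H4]]]]] := mala_small_step hlam h01 k1 n1 n2.
  exists f, pi0; split=> //; split=> //; split=> // T HT; apply: H4.
  have L20 : 0 < L ^+ 2 by lra.
  apply: (@le_trans _ _ ((32 * C)^-1 * kappa * D / L ^+ 2 * h)).
    by rewrite ler_wpM2r// ltW.
  rewrite (_ : _ * h = (32 * C)^-1 * (h * kappa * D / L ^+ 2)); last first.
    by field; rewrite !gt_eqF//; lra.
  apply: (@le_trans _ _ ((32 * C)^-1 * C)).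
    by rewrite ler_wpM2l ?invr_ge0 ?ler_pdivrMr//; lra.
  by rewrite invfM -mulrA mulVf ?mulr1// gt_eqF.
(* The largest number of bent coordinates that the budget allows. As [D / (100 L) >= 1], rounding
   down at most halves it, whence [D <= m * 200 L]. *)
pose m := Num.truncn (D / (100 * L)).
have L0 : 0 < L by lra.
have x1 : 1 <= D / (100 * L) by rewrite ler_pdivlMr ?mul1r// mulr_gt0.
have /andP[m1 m2] : m%:R <= D / (100 * L) < m.+1%:R.
  by apply: truncn_itv; lra.
have mL : m%:R * (100 * L) <= D by rewrite -ler_pdivlMr// mulr_gt0.
have m3 : 1 <= m%:R :> R by rewrite ler1n truncn_gt0.
have m4 : D <= m%:R * (200 * L).
  have : D <= m.+1%:R * (100 * L) by rewrite -ler_pdivrMr ?(ltW m2)// mulr_gt0.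
  rewrite -natr1; nra.
have m5 : m%:R <= D / 100.
  by rewrite ler_pdivlMr//; apply: le_trans mL; rewrite ler_wpM2l// ler_peMr.
have mn : (m <= d)%N.
  by rewrite -(@ler_nat R); apply: le_trans m5 _; rewrite -/D; lra.
have dm : (d - m)%:R = D - m%:R :> R by rewrite natrB.
have n1 : (3 / 4) ^+ (d - m) <= 4^-1 :> R.
  rewrite (_ : 3 / 4 = 1 - 4^-1 :> R); last by field.
  apply: le_trans (onem_expn_le_expR _ _) _; first by lra.
  by apply: expRN_le_quarter; rewrite dm; lra.
set H := h * kappa in hk1 hC *.
have H0 : 0 < H by rewrite mulr_gt0.
have HD : C <= H * D.
  by apply: ltW; apply: le_lt_trans hC; rewrite ler_peMr// ltW.
have Dm2 : expR (- (2 * L)) <= H ^+ 2 / (512 * 96).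
  have -> : - (2 * L) = 2%:R * - L by ring.
  rewrite expRM_natl expRN lnK ?posrE// exprVn.
  rewrite -[leLHS]mul1r ler_pdivrMr ?exprn_gt0//.
  exact: Cmass.
have n2 : expR (- d%:R) <= (H ^+ 2 / (512 * 96)) ^+ m * expR (- (49 / 50)) ^+ (d - m).
  apply: (@le_trans _ _ (expR (- (2 * L)) ^+ m * expR (- (49 / 50)) ^+ (d - m))).
    by rewrite -!expRM_natl -expRD ler_expR dm; exact: hard_count_numerics.
  rewrite ler_wpM2r ?exprn_ge0 ?expR_ge0//.
  apply: lerXn2r; [rewrite nnegrE; exact: expR_ge0|rewrite nnegrE|exact: Dm2].
  exact: le_trans (expR_ge0 _) Dm2.
have [f [pi0 [H1 [H2 [H3 H4]]]]] := mala_mid_step hlam h0 k10 hk1 mn n1 n2.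
exists f, pi0; split=> //; split=> //; split=> // T /TD HT; apply: H4.
rewrite -/H -expRM_natl.
(* Acceptance at most [D^(-6)] outweighs the horizon of order [D^5]. *)
have e : expR (m%:R * - (H / (64 * 96))) <= D ^- 6.
  have -> : D ^- 6 = expR (6%:R * - L) by rewrite expRM_natl expRN lnK ?posrE// exprVn.
  rewrite ler_expR; apply: Caccept => //.
  by apply: le_trans (ltW hC) _; rewrite ler_wpM2l// ltW.
apply: (@le_trans _ _ ((32 * C)^-1 * D ^+ 5 * D ^- 6)).
  by apply: ler_pM => //; exact: expR_ge0.
apply: le_trans C4; rewrite -mulrA ler_piMr//.
by rewrite ler_pdivrMr ?exprn_gt0// mul1r (exprS D 5) ler_peMl// exprn_ge0// ltW.
Qed.
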